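(* There are universal constants $c,C>0$ such that, with $\sigma=c\beta$, the following holds. Let $\epsilon\in(0,1)$. Run the Online Lagrangian Frank-Wolfe (OLFW) algorithm with update rule (II), with parameters $\mu=\frac{R}{\beta\sqrt T}$, $K=\sqrt T$, $\delta=\beta^2$ and $\gamma_t=\sqrt{\frac{2G^2\log(2T/\epsilon)}{t}}$ for $t=2,\dots,T$. Then, with probability at least $1-\epsilon$, $$C_T\le\sqrt{2G^2T\log\Big(\frac{2T}{\epsilon}\Big)}+CR\sigma\sqrt{T\log\Big(\frac{2nT}{\epsilon}\Big)}+\frac{T}{B_T}R\beta F\sqrt T+\frac{TR\beta}{B_T}\Big(\frac{LR^2}{2}+2R\beta\Big)+R\beta .$$ So, one obtains a $\tilde{O}(\sqrt T)$ constraint violation bound with high probability (where $\tilde O$ hides logarithmic factors and $n,R,\beta,L,F,G,\sigma$ and $T/B_T$ are treated as constants).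
   Context: Setting. $n,T$ are positive integers, $\|\cdot\|$ is the Euclidean norm, $[u]_+=\max\{u,0\}$, and $\preceq$ is the entrywise order on $\mathbb{R}^n$. $\mathcal{X}\subset\mathbb{R}_+^n$ is closed, bounded, convex, contains $0$, and has diameter $R=\max_{x,y\in\mathcal{X}}\|x-y\|$. $B_T>0$ is a fixed budget. A differentiable $f:\mathcal{X}\to\mathbb{R}$ is DR-submodular if $x\succeq y$ implies $\nabla f(x)\preceq\nabla f(y)$; it is monotone if $x\preceq y$ implies $f(x)\le f(y)$. The utilities $f_1,\dots,f_T:\mathcal{X}\to\mathbb{R}_+$ form an arbitrary fixed sequence of differentiable functions; each is normalized ($f_t(0)=0$), monotone, DR-submodular, $\beta_f$-Lipschitz ($|f_t(y)-f_t(x)|\le\beta_f\|y-x\|$), and $L$-smooth in the sense that $f_t(x+u)-f_t(x)\ge\langle u,\nabla f_t(x)\rangle-\frac L2\|u\|^2$ for all $x\in\mathcal{X}$ and all $u\succeq0$ or $u\preceq0$ (with $x+u$ in the domain). The random vectors $p_1,\dots,p_T$ are i.i.d. from a distribution $\mathcal{D}$ supported in $\{v\in\mathbb{R}^n_+:\|v\|\le\beta_p\}$ with mean $p\succeq0$ and covariance matrix $\Sigma$. Let $\beta=\max\{\beta_f,\beta_p\}$, $F=\max_{t}\max_{x,y\in\mathcal{X}}|f_t(x)-f_t(y)|$, and $G=\max_{p'}\max_{x\in\mathcal{X}}|\langle p',x\rangle-\frac{B_T}{T}|$, with $p'$ ranging over the support of $\mathcal{D}$. The quantity $\sigma=c\beta$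 is a norm-sub-Gaussian parameter of $p_t$: $\mathbb{P}\{\|p_t-p\|\ge\zeta\}\le2e^{-\zeta^2/(2\sigma^2)}$ for all $\zeta\geq 0$. Protocol. At each round $t$ the algorithm chooses $x_t\in\mathcal{X}$, after which $f_t$ and $p_t$ are revealed. OLFW algorithm. Inputs: $\mu>0$, $\delta>0$, a positive integer $K$, real numbers $\gamma_t$. Let $\widehat p_t=\frac1{t-1}\sum_{s=1}^{t-1}p_s$ for $t>1$ (convention: $\widehat p_1=0$, $\gamma_1=0$). Define $\widetilde g_t(x)=\langle\widehat p_t,x\rangle-\frac{B_T}{T}$ under update rule (I), and $\widetilde g_t(x)=\langle\widehat p_t,x\rangle-\frac{B_T}{T}-\gamma_t$ under update rule (II). For each $k=1,\dots,K$ an instance of projected online gradient ascent over $\mathcal{X}$ with step size $\mu$ is kept, starting from an arbitrary fixed $v_1^{(k)}\in\mathcal{X}$. At round $t$: set $x_t^{(1)}=0$, $x_t^{(k+1)}=x_t^{(k)}+\frac1Kv_t^{(k)}$ for $k=1,\dots,K$, and play $x_t=x_t^{(K+1)}$. Set $\lambda_1=0$ and $\lambda_t=\frac{[\widetilde g_t(x_t)]_+}{\delta\mu}$ for $t>1$. With $\mathcal{L}_t(x,\lambda)=f_t(x)-\lambda\widetilde g_t(x)+\frac{\delta\mu}{2}\lambda^2$, the $k$-th instance receives the linear payoff $v\mapsto\langle v,\nabla_x\mathcal{L}_t(x_t^{(k)},\lambda_t)\rangle$, i.e. $v_{t+1}^{(k)}$ is the Euclidean projection onto $\mathcal{X}$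 of $v_t^{(k)}+\mu\nabla_x\mathcal{L}_t(x_t^{(k)},\lambda_t)$. Performance metric. The cumulative constraint violation is $C_T=\sum_{t=1}^T\langle p,x_t\rangle-B_T$. $K=\sqrt T$ is understood to be an integer. Probability is over the draw of $p_1,\dots,p_T$. *)

(* Defs.v *)
From HB Require Import structures.
From mathcomp Require Import all_boot all_order all_algebra.
From mathcomp Require Import all_classical all_reals all_analysis.
From mathcomp Require Import ring.

Set Implicit Arguments.
Unset Strict Implicit.
Unset Printing Implicit Defensive.

Import Order.TTheory GRing.Theory Num.Theory.
Import numFieldNormedType.Exports.

Local Open Scope classical_set_scope.
Local Open Scope ring_scope.

(* The library norm `|x| on 'rV[R]_n is the sup norm, so the Euclidean norm is
   introduced separately.  Topology and boundedness do not depend on this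
   choice, and are taken from the library. *)
Definition dotv (R : realType) (n : nat) (x y : 'rV[R]_n) : R :=
  \sum_(i < n) x 0 i * y 0 i.

Definition enorm (R : realType) (n : nat) (x : 'rV[R]_n) : R :=
  Num.sqrt (dotv x x).

Definition lev (R : realType) (n : nat) (x y : 'rV[R]_n) : Prop :=
  forall i, x 0 i <= y 0 i.

Definition diameter (R : realType) (n : nat) (X : set 'rV[R]_n) : R :=
  sup [set enorm (z.1 - z.2) | z in X `*` X].

Definition euclidean_projection (R : realType) (n : nat) (X : set 'rV[R]_n)
    (z y : 'rV[R]_n) : Prop :=
  X y /\ forall w, X w -> enorm (z - y) <= enorm (z - w).

Record decision_set (R : realType) (n : nat) (X : set 'rV[R]_n) : Prop := {
  decision_set_ge0 : forall x, X x -> lev 0 x;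
  decision_set_closed : closed X;
  decision_set_bounded : bounded_set X;
  decision_set_convex : convex_set X;
  decision_set_0 : X 0
}.

(* Functions are total on 'rV[R]_n but are only ever constrained on X.  Hence
   differentiability is relative to X: g x is a gradient of f at x when
   f y = f x + <g x, y - x> + o(|y - x|) as y tends to x within X.  When X has
   empty interior g is not determined by f; any choice is allowed. *)
Definition gradient_on (R : realType) (n : nat) (X : set 'rV[R]_n)
    (f : 'rV[R]_n -> R) (g : 'rV[R]_n -> 'rV[R]_n) : Prop :=
  forall x, X x ->
    (fun y => (f y - f x - dotv (g x) (y - x)) / enorm (y - x))
      @ within X (nbhs x) --> (0 : R).

Record utility (R : realType) (n : nat) (X : set 'rV[R]_n) (beta_f L : R)
    (f : 'rV[R]_n -> R) (gradf : 'rV[R]_n -> 'rV[R]_n) : Prop := {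
  utility_ge0 : forall x, X x -> 0 <= f x;
  utility_gradient : gradient_on X f gradf;
  utility_normalized : f 0 = 0;
  utility_monotone : forall x y, X x -> X y -> lev x y -> f x <= f y;
  utility_DR_submodular :
    forall x y, X x -> X y -> lev y x -> lev (gradf x) (gradf y);
  utility_Lipschitz :
    forall x y, X x -> X y -> `|f y - f x| <= beta_f * enorm (y - x);
  utility_smooth :
    forall x u, X x -> X (x + u) -> lev 0 u \/ lev u 0 ->
      dotv u (gradf x) - L / 2 * enorm u ^+ 2 <= f (x + u) - f x
}.

Definition utility_range (R : realType) (n : nat) (X : set 'rV[R]_n) (T : nat)
    (f : nat -> 'rV[R]_n -> R) : R :=
  sup [set r | exists t x y,
    [/\ (1 <= t <= T)%N, X x, X y & r = `|f t x - f t y| ]].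

Definition borel_rV (R : realType) (n : nat) :=
  g_sigma_algebraType (@open 'rV[R]_n).

Definition prob_support (R : realType) (n : nat)
    (D : probability (borel_rV R n) R) : set 'rV[R]_n :=
  [set v | forall U : set 'rV[R]_n, open U -> U v -> (0 < D U)%E].

Definition mean_vector (R : realType) (n : nat)
    (D : probability (borel_rV R n) R) : 'rV[R]_n :=
  \row_(i < n) Rintegral D setT (fun v : 'rV[R]_n => v 0 i).

Definition constraint_range (R : realType) (n : nat) (X : set 'rV[R]_n)
    (T : nat) (B : R) (D : probability (borel_rV R n) R) : R :=
  sup [set `|dotv z.1 z.2 - B / T%:R| | z in prob_support D `*` X].

(* Rounds are numbered from 1 to T; X_ t is unconstrained for other t. *)
Definition iid (d d' : measure_display) (Omega : measurableType d)
    (S : measurableType d') (R : realType) (P : probability Omega R) (T : nat)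
    (D : probability S R) (X_ : nat -> {RV P >-> S}) : Prop :=
  (forall t, (1 <= t <= T)%N ->
    forall A, measurable A -> distribution P (X_ t) A = D A) /\
  (forall (s : seq nat) (A : nat -> set S), uniq s ->
    (forall t, t \in s -> (1 <= t <= T)%N) ->
    (forall t, measurable (A t)) ->
    P (\bigcap_(t in [set` s]) (X_ t @^-1` A t)) =
    (\prod_(t <- s) P (X_ t @^-1` A t))%E).

(* For t = 1 the sum is empty, so that empirical_mean p 1 = 0. *)
Definition empirical_mean (R : realType) (n : nat) (p : nat -> 'rV[R]_n)
    (t : nat) : 'rV[R]_n :=
  (t.-1)%:R^-1 *: \sum_(1 <= s < t) p s.

Definition surrogate_constraint (R : realType) (n T : nat) (B : R)
    (gamma : nat -> R) (p : nat -> 'rV[R]_n) (t : nat) (x : 'rV[R]_n) : R :=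
  dotv (empirical_mean p t) x - B / T%:R - gamma t.

Definition lagrangian (R : realType) (n T : nat) (B mu delta : R)
    (gamma : nat -> R) (f : nat -> 'rV[R]_n -> R) (p : nat -> 'rV[R]_n)
    (t : nat) (x : 'rV[R]_n) (lambda : R) : R :=
  f t x - lambda * surrogate_constraint T B gamma p t x
    + delta * mu / 2 * lambda ^+ 2.

(* See gradient_on_lagrangian below. *)
Definition lagrangian_grad (R : realType) (n : nat)
    (gradf : nat -> 'rV[R]_n -> 'rV[R]_n) (p : nat -> 'rV[R]_n)
    (t : nat) (x : 'rV[R]_n) (lambda : R) : 'rV[R]_n :=
  gradf t x - lambda *: empirical_mean p t.

(* A run of the algorithm against the sample p: x t k and v t k are the k-th
   Frank-Wolfe iterate and direction of round t, x t K.+1 is the point played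
   and lambda t the dual variable. *)
Record OLFW_run (R : realType) (n : nat) (X : set 'rV[R]_n) (T K : nat)
    (B mu delta : R) (gamma : nat -> R) (v1 : nat -> 'rV[R]_n)
    (gradf : nat -> 'rV[R]_n -> 'rV[R]_n) (p : nat -> 'rV[R]_n)
    (x v : nat -> nat -> 'rV[R]_n) (lambda : nat -> R) : Prop := {
  OLFW_direction_init : forall k, (1 <= k <= K)%N -> v 1%N k = v1 k;
  OLFW_iterate_init : forall t, (1 <= t <= T)%N -> x t 1%N = 0;
  OLFW_iterate_step : forall t k, (1 <= t <= T)%N -> (1 <= k <= K)%N ->
    x t k.+1 = x t k + K%:R^-1 *: v t k;
  OLFW_dual_init : lambda 1%N = 0;
  OLFW_dual : forall t, (1 < t <= T)%N ->
    lambda t =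
      Num.max (surrogate_constraint T B gamma p t (x t K.+1)) 0 / (delta * mu);
  OLFW_direction_step : forall t k, (1 <= t <= T)%N -> (1 <= k <= K)%N ->
    euclidean_projection X
      (v t k + mu *: lagrangian_grad gradf p t (x t k) (lambda t)) (v t.+1 k)
}.

Definition constraint_violation (R : realType) (n T : nat) (B : R)
    (pbar : 'rV[R]_n) (x : nat -> 'rV[R]_n) : R :=
  \sum_(1 <= t < T.+1) dotv pbar (x t) - B.

Definition violation_bound (R : realType) (C : R) (n : nat)
    (diam beta L F G sigma : R) (T : nat) (B eps : R) : R :=
  Num.sqrt (2 * G ^+ 2 * T%:R * ln (2 * T%:R / eps))
  + C * diam * sigma * Num.sqrt (T%:R * ln (2 * n%:R * T%:R / eps))
  + T%:R / B * diam * beta * F * Num.sqrt T%:R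
  + T%:R * diam * beta / B * (L * diam ^+ 2 / 2 + 2 * diam * beta)
  + diam * beta.

Lemma dotvBr (R : realType) (n : nat) (a x y : 'rV[R]_n) :
  dotv a (x - y) = dotv a x - dotv a y.
Proof.
by rewrite /dotv -sumrB; apply: eq_bigr => i _; rewrite !mxE mulrBr.
Qed.

Lemma dotvBZl (R : realType) (n : nat) (a b : 'rV[R]_n) (l : R)
    (x : 'rV[R]_n) : dotv (a - l *: b) x = dotv a x - l * dotv b x.
Proof.
rewrite /dotv mulr_sumr -sumrB; apply: eq_bigr => i _.
by rewrite !mxE mulrBl mulrA.
Qed.

Lemma gradient_on_lagrangian (R : realType) (n T : nat) (X : set 'rV[R]_n)
    (B mu delta : R) (gamma : nat -> R) (f : nat -> 'rV[R]_n -> R)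
    (gradf : nat -> 'rV[R]_n -> 'rV[R]_n) (p : nat -> 'rV[R]_n)
    (t : nat) (lambda : R) :
  gradient_on X (f t) (gradf t) ->
  gradient_on X
    (fun x => lagrangian T B mu delta gamma f p t x lambda)
    (fun x => lagrangian_grad gradf p t x lambda).
Proof.
move=> fg x Xx; set h := (X in X @ _ --> _).
rewrite [h](_ : _ = fun y =>
  (f t y - f t x - dotv (gradf t x) (y - x)) / enorm (y - x)); first exact: fg.
apply/funext => y; congr (_ / _).
rewrite /lagrangian /lagrangian_grad /surrogate_constraint dotvBZl !dotvBr.
by ring.
Qed.

(* Main.v *)
Require Import Defs.
From HB Require Import structures.
From mathcomp Require Import all_boot all_order all_algebra.
From mathcomp Require Import all_classical all_reals all_analysis.
From mathcomp Require Import measurable_realfun ring lra.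

(* Deterministic part: comparing the directions of online gradient ascent with
   the zero action, for which the surrogate constraint has slack at least B / T,
   and using that the dual variable minimizes the regularized Lagrangian, one
   bounds (B / T) * sum_t lambda_t, hence the sum of the surrogate violations.

   Random part: replacing p_t by its mean costs diam * |mean - empirical mean|
   per round.  For centered independent summands of norm at most b, the
   exponential moments of the squared norm of the partial sums obey
     E exp(theta |S + Z|^2)
       <= exp(theta b^2) * E exp(theta (1 + 8 theta b^2) |S|^2),
   because the cross term 2 theta <S, Z> is centered and bounded given S.
   Iterating gives a dimension-free sub-Gaussian tail for |S_k|, and a union
   bound over the rounds finishes the proof. *)

Set Implicit Arguments.
Unset Strict Implicit.
Unset Printing Implicit Defensive.

Import Order.TTheory GRing.Theory Num.Theory.
Import numFieldNormedType.Exports.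

Local Open Scope classical_set_scope.
Local Open Scope ring_scope.

(** * Euclidean geometry and projections *)

(** The squared norm is used because it expands exactly, |S + Z|^2 = |S|^2 + 2 <S, Z> + |Z|^2: only
    a scalar centered variable has to be handled, and the [ln n] in the bound is pure slack. The
    price is an exponent that grows when a summand is removed, so the exponents have to decrease
    along the walk. Integrating the cross term with S fixed requires the law of (S_k, p_{k+1}) to be
    a product measure, whereas [iid] only speaks of events attached to single samples. Independence
    of S_k from all later events is therefore propagated along the walk. The constants fit together
    as follows. Centered samples have norm at most 2 beta, hence c = 2. With steps of that size the
    tail bound equals eps / T at radius 8 beta sqrt(k ln(2T/eps)). This 8 and a 2 for gamma_t give C
    = 10, and the 2 from summing 1/sqrt(t) is the one in sigma = 2 beta. *)

Section euclidean.
Variables (R : realType) (n : nat).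
Implicit Types (x y z : 'rV[R]_n) (a : R).

Lemma dotvC x y : dotv x y = dotv y x.
Proof. by apply: eq_bigr => i _; rewrite mulrC. Qed.

Lemma dotvDr x y z : dotv x (y + z) = dotv x y + dotv x z.
Proof. by rewrite /dotv -big_split; apply: eq_bigr => i _; rewrite !mxE mulrDr. Qed.

Lemma dotvZr x a y : dotv x (a *: y) = a * dotv x y.
Proof. by rewrite /dotv mulr_sumr; apply: eq_bigr => i _; rewrite !mxE mulrCA. Qed.

Lemma dotv0 x : dotv x 0 = 0.
Proof. by rewrite /dotv big1 // => i _; rewrite mxE mulr0. Qed.

Lemma dotvNr x y : dotv x (- y) = - dotv x y.
Proof. by rewrite -scaleN1r dotvZr mulN1r. Qed.

Lemma dotvDl x y z : dotv (x + y) z = dotv x z + dotv y z.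
Proof. by rewrite !(dotvC _ z) dotvDr. Qed.

Lemma dotvZl a x y : dotv (a *: x) y = a * dotv x y.
Proof. by rewrite !(dotvC _ y) dotvZr. Qed.

Lemma dotv0l x : dotv 0 x = 0. Proof. by rewrite dotvC dotv0. Qed.

Lemma dotvNl x y : dotv (- x) y = - dotv x y.
Proof. by rewrite !(dotvC _ y) dotvNr. Qed.

Lemma dotvBl x y z : dotv (x - y) z = dotv x z - dotv y z.
Proof. by rewrite dotvDl dotvNl. Qed.

Lemma dotv_sumr x (I : Type) (r : seq I) (F : I -> 'rV[R]_n) :
  dotv x (\sum_(i <- r) F i) = \sum_(i <- r) dotv x (F i).
Proof.
elim: r => [|i r IH]; first by rewrite !big_nil dotv0.
by rewrite !big_cons dotvDr IH.
Qed.

Lemma dotv_ge0 x y : lev 0 x -> lev 0 y -> 0 <= dotv x y.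
Proof.
move=> x0 y0; apply: sumr_ge0 => i _.
by apply: mulr_ge0; [move: (x0 i)|move: (y0 i)]; rewrite mxE.
Qed.

Lemma dotvv_ge0 x : 0 <= dotv x x.
Proof. by apply: sumr_ge0 => i _; rewrite -expr2 sqr_ge0. Qed.

Lemma enorm_ge0 x : 0 <= enorm x.
Proof. exact: sqrtr_ge0. Qed.

Lemma sqr_enorm x : enorm x ^+ 2 = dotv x x.
Proof. by rewrite sqr_sqrtr // dotvv_ge0. Qed.

Lemma enorm_eq0 x : (enorm x == 0) = (x == 0).
Proof.
apply/eqP/eqP => [x0|->]; last by rewrite /enorm dotv0 sqrtr0.
have : dotv x x = 0 by rewrite -sqr_enorm x0 expr0n.
move=> /eqP; rewrite /dotv psumr_eq0 => [/allP h|i _]; last by rewrite -expr2 sqr_ge0.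
apply/rowP => i; rewrite mxE; apply/eqP.
by have := h i (mem_index_enum i); rewrite mulf_eq0 orbb.
Qed.

Lemma enorm0 : enorm (0 : 'rV[R]_n) = 0.
Proof. by apply/eqP; rewrite enorm_eq0. Qed.

Lemma enormZ a x : enorm (a *: x) = `|a| * enorm x.
Proof.
by rewrite /enorm dotvZl dotvZr mulrA -expr2 sqrtrM ?sqr_ge0 // sqrtr_sqr.
Qed.

Lemma enormN x : enorm (- x) = enorm x.
Proof. by rewrite -scaleN1r enormZ normrN1 mul1r. Qed.

Lemma dotv_le_enorm x y : dotv x y <= enorm x * enorm y.
Proof.
have [->|x0] := eqVneq x 0; first by rewrite dotv0l enorm0 mul0r.
have [->|y0] := eqVneq y 0; first by rewrite dotv0 enorm0 mulr0.
have xp : 0 < enorm x by rewrite lt_def enorm_eq0 x0 enorm_ge0.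
have yp : 0 < enorm y by rewrite lt_def enorm_eq0 y0 enorm_ge0.
have := dotvv_ge0 (enorm y *: x - enorm x *: y).
have -> : dotv (enorm y *: x - enorm x *: y) (enorm y *: x - enorm x *: y)
    = 2 * (enorm x * enorm y) * (enorm x * enorm y - dotv x y).
  by rewrite dotvBr !dotvBl !dotvZr !dotvZl -!sqr_enorm (dotvC y x); ring.
by rewrite pmulr_rge0 ?subr_ge0 // mulr_gt0 ?mulr_gt0.
Qed.

Lemma ler_enormD x y : enorm (x + y) <= enorm x + enorm y.
Proof.
rewrite -(@ler_pXn2r _ 2) ?nnegrE ?addr_ge0 ?enorm_ge0 //.
rewrite sqr_enorm dotvDr !dotvDl -!sqr_enorm sqrrD (dotvC y x).
have := dotv_le_enorm x y; lra.
Qed.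

Lemma enorm_coord x i : `|x 0 i| <= enorm x.
Proof.
rewrite -(@ler_pXn2r _ 2) ?nnegrE ?enorm_ge0 // sqr_enorm /dotv (bigD1 i) //=.
rewrite real_normK ?num_real // expr2 lerDl.
by apply: sumr_ge0 => j _; rewrite -expr2 sqr_ge0.
Qed.

Lemma enorm_le_sum x : enorm x <= \sum_(i < n) `|x 0 i|.
Proof.
have s0 : 0 <= \sum_(i < n) `|x 0 i| by apply: sumr_ge0.
rewrite -(@ler_pXn2r _ 2) ?nnegrE ?enorm_ge0 // sqr_enorm expr2 mulr_suml.
apply: ler_sum => i _; apply: (le_trans (ler_norm _)); rewrite normrM.
by rewrite ler_wpM2l // (bigD1 i) //= lerDl sumr_ge0.
Qed.

Lemma enorm_le_norm x : enorm x <= n%:R * `|x|.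
Proof.
apply: (le_trans (enorm_le_sum x)).
rewrite mulr_natl -[X in _ *+ X]card_ord -sumr_const; apply: ler_sum => i _.
rewrite [leRHS]/Num.norm /= mx_normrE.
by apply: (le_bigmax _ (fun ij : 'I_1 * 'I_n => `|x ij.1 ij.2|) (0, i)).
Qed.

End euclidean.

Section convex_body.
Variables (R : realType) (n : nat) (X : set 'rV[R]_n).
Implicit Types (x y z w : 'rV[R]_n).

Lemma convex_set_segment x y (a : R) :
  convex_set X -> X x -> X y -> 0 <= a <= 1 -> X (x + a *: (y - x)).
Proof.
move=> cX Xx Xy /andP[a0 a1].
have := cX y x (Itv01 a0 a1); rewrite !inE => /(_ Xy Xx).
rewrite /conv /=; congr X.
by rewrite scalerBl scale1r scalerBr addrCA.
Qed.

Lemma euclidean_projection_obtuse z y w : convex_set X ->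
  euclidean_projection X z y -> X w -> dotv (z - y) (w - y) <= 0.
Proof.
move=> cX [Xy minY] Xw; rewrite leNgt; apply/negP.
set a := dotv _ _ => a0.
set q := dotv (w - y) (w - y); have q0 : 0 <= q := dotvv_ge0 _.
(* Moving from [y] towards [w] by [s] changes the squared distance to [z] by
   [- 2 * s * a + s ^+ 2 * q]. This [s] lies in (0, 1], also when [q = 0], and [s * q <= a], so the
   distance strictly drops. *)
set s := a / (a + q).
have aq0 : 0 < a + q by rewrite ltr_pwDl.
have s0 : 0 < s by rewrite divr_gt0.
have s1 : s <= 1 by rewrite ler_pdivrMr // mul1r lerDl.
have := minY _ (convex_set_segment cX Xy Xw (introT andP (conj (ltW s0) s1))).
rewrite -(@ler_pXn2r _ 2) ?nnegrE ?enorm_ge0 // !sqr_enorm.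
have -> : z - (y + s *: (w - y)) = (z - y) - s *: (w - y).
  by rewrite opprD addrA.
move: @a a0 @q q0 @s aq0 s0 s1; move: (z - y) (w - y) => d e /= a0 q0 aq0 s0 s1.
set s := _ / _ in s0 s1 *.
rewrite dotvBr !dotvBl !dotvZr !dotvZl (dotvC e d).
set a := dotv d e in a0 aq0 s s0 s1 *; set q := dotv e e in q0 aq0 s s0 s1 *.
have sq : s * q <= a.
  by rewrite mulrAC ler_pdivrMr // ler_pM2l // lerDr ltW.
have sa : 0 < s * a by rewrite mulr_gt0.
have : s * (s * q) <= s * a by rewrite ler_pM2l.
lra.
Qed.

(** The obtuse angle at [y] handles the part of [u - v] beyond [y]; what remains is
    [2 * mu * dotv g d - |d|^2] with [d = y - v], at most [mu ^+ 2 * M ^+ 2]. Hence [M] only has to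
    bound [g] along the step actually taken, not the norm of [g]. *)
Lemma online_gradient_step (mu M : R) g v y u : convex_set X -> 0 < mu ->
  X v -> X u -> euclidean_projection X (v + mu *: g) y ->
  dotv g (y - v) <= M * enorm (y - v) ->
  2 * mu * dotv g (u - v)
    <= enorm (v - u) ^+ 2 - enorm (y - u) ^+ 2 + mu ^+ 2 * M ^+ 2.
Proof.
move=> cX mu0 Xv Xu yP gM.
have := euclidean_projection_obtuse cX yP Xu.
set d := y - v in gM *; set e := u - y.
have -> : v + mu *: g - y = mu *: g - d by rewrite /d opprB [RHS]addrA [v + _]addrC.
have -> : v - u = - (d + e) by rewrite [d + e]addrC subrKA opprB.
have -> : y - u = - e by rewrite opprB.
have -> : u - v = d + e by rewrite [d + e]addrC subrKA.
clearbody d e; rewrite !enormN dotvBl dotvZl dotvDr !sqr_enorm dotvDr !dotvDl (dotvC e d).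
have : mu * dotv g d <= mu * (M * enorm d) by rewrite ler_pM2l.
have := sqr_ge0 (enorm d - mu * M); rewrite sqrrB sqr_enorm exprMn.
nra.
Qed.

Lemma diameter_ge x y : bounded_set X -> X x -> X y ->
  enorm (x - y) <= diameter X.
Proof.
move=> [M [Mr HM]] Xx Xy.
apply: ub_le_sup; last by exists (x, y).
have hM z : X z -> `|z| <= M + 1 by apply: HM; rewrite ltrDl.
exists (n%:R * (M + 1 + (M + 1))) => _ [[a b] [/= Xa Xb] <-].
apply: (le_trans (enorm_le_norm _)); rewrite ler_wpM2l //.
by apply: (le_trans (ler_normB _ _)); rewrite lerD // hM.
Qed.

(* The Lipschitz bound passes to the linearization of f at x, the limit of its
   rescalings around x: this controls g only along X - X, which is all that
   projected gradient steps see. *)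
Lemma gradient_on_Lipschitz (f : 'rV[R]_n -> R) g (b : R) x y z :
  convex_set X -> gradient_on X f g ->
  (forall y z, X y -> X z -> `|f z - f y| <= b * enorm (z - y)) ->
  X x -> X y -> X z -> dotv (g x) (y - z) <= b * enorm (y - z).
Proof.
move=> cX fg fL Xx Xy Xz.
(* The linearization errors at two points shrunk towards [x] are proportional to their distances
   from [x], so dividing by the scale leaves an error [e] that is arbitrarily small. *)
suff H (e : R) : 0 < e ->
    dotv (g x) (y - z) <= b * enorm (y - z) + e * (enorm (y - x) + enorm (z - x)).
  have q0 : 0 <= enorm (y - x) + enorm (z - x) by rewrite addr_ge0 ?enorm_ge0.
  have q1 : 0 < enorm (y - x) + enorm (z - x) + 1 by rewrite ltr_wpDl.
  apply/ler_addgt0Pr => e e0.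
  apply: (le_trans (H _ (divr_gt0 e0 q1))); rewrite lerD2l.
  by rewrite mulrAC ler_pdivrMr // ler_pM2l // lerDl.
move=> e0.
have /cvgr_dist_lt /(_ e e0) := fg x Xx.
rewrite near_withinE => /nbhs_ballP[r /= r0 Hr].
have key w : X w -> `|w - x| < r ->
    `|f w - f x - dotv (g x) (w - x)| <= e * enorm (w - x).
  move=> Xw wr; have [->|wx] := eqVneq w x.
    by rewrite !subrr dotv0 subr0 normr0 enorm0 mulr0.
  have w0 : 0 < enorm (w - x) by rewrite lt_def enorm_eq0 subr_eq0 wx enorm_ge0.
  have : `|0 - (f w - f x - dotv (g x) (w - x)) / enorm (w - x)| < e.
    apply: Hr => //; rewrite -ball_normE /ball_ /=.
    by rewrite distrC.
  rewrite sub0r normrN normrM normfV (gtr0_norm w0) ltr_pdivrMr //.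
  exact: ltW.
(* The common scale [s] brings both [y] and [z] within [r] of [x]; the [+ 1] keeps [N] positive when
   all three points coincide. *)
set N := `|y - x| + `|z - x| + 1.
have N0 : 0 < N by rewrite ltr_wpDl // addr_ge0.
set s := Num.min 1 (r / (2 * N)).
have s0 : 0 < s by rewrite lt_min ltr01 divr_gt0 // mulr_gt0.
have s1 : s <= 1 by rewrite ge_min lexx.
have sN w : `|w - x| <= N -> `|x + s *: (w - x) - x| < r.
  move=> wN; rewrite addrC addKr normrZ gtr0_norm //.
  apply: (@le_lt_trans _ _ (r / (2 * N) * N)).
    by apply: ler_pM; rewrite ?(ltW s0) // ge_min lexx orbT.
  by rewrite invfM mulrA mulfVK ?gt_eqF // ltr_pdivrMr // ltr_pMr // ltr1n.
have s01 : 0 <= s <= 1 by rewrite s1 ltW.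
have yN : `|y - x| <= N by rewrite /N -addrA lerDl addr_ge0.
have zN : `|z - x| <= N by rewrite /N addrAC lerDr addr_ge0.
have Xy' := convex_set_segment cX Xx Xy s01.
have Xz' := convex_set_segment cX Xx Xz s01.
have := key _ Xy' (sN _ yN); have := key _ Xz' (sN _ zN).
have /ler_normlP[_] := fL _ _ Xz' Xy'.
have -> : x + s *: (y - x) - (x + s *: (z - x)) = s *: (y - z).
  by rewrite opprD addrACA subrr add0r -scalerBr opprB addrA subrK.
rewrite ![x + _]addrC !addrK !dotvZr !enormZ gtr0_norm //.
move=> h1 /ler_normlP[h2 h2'] /ler_normlP[h3 h3'].
rewrite -(ler_pM2l s0) !dotvBr.
move: h1 h2 h2' h3 h3'; rewrite !dotvBr; lra.
Qed.

End convex_body.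

(** * The deterministic analysis of a run *)

Lemma enorm_sum (R : realType) (n : nat) (I : Type) (r : seq I) (P : pred I)
    (F : I -> 'rV[R]_n) :
  enorm (\sum_(i <- r | P i) F i) <= \sum_(i <- r | P i) enorm (F i).
Proof.
elim/big_rec2: _ => [|i a x _ ax]; first by rewrite enorm0.
by apply: (le_trans (ler_enormD _ _)); rewrite lerD2l.
Qed.

Lemma enorm_empirical_mean (R : realType) (n : nat) (p : nat -> 'rV[R]_n)
    (b : R) (t : nat) : 0 <= b ->
  (forall s, (1 <= s < t)%N -> enorm (p s) <= b) -> enorm (empirical_mean p t) <= b.
Proof.
move=> b0 pb; rewrite /empirical_mean enormZ ger0_norm ?invr_ge0 //.
(* For [t <= 1] the average is 0, since the inverse of 0 is 0. *)
have [->|t0] := posnP t.-1; first by rewrite invr0 mul0r.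
rewrite mulrC ler_pdivrMr ?ltr0n //; apply: (le_trans (enorm_sum _ _ _)).
rewrite big_nat; apply: (@le_trans _ _ (\sum_(1 <= s < t) b)).
  by rewrite [leRHS]big_nat; apply: ler_sum.
by rewrite sumr_const_nat subn1 mulr_natr.
Qed.

(** The [K - m] missing points count as copies of 0, which lies in [X]. This keeps every partial
    Frank-Wolfe iterate feasible. *)
Lemma convex_set_average (R : realType) (n : nat) (X : set 'rV[R]_n)
    (v : nat -> 'rV[R]_n) (K m : nat) : convex_set X -> X 0 ->
  (forall k, (1 <= k <= K)%N -> X (v k)) -> (m <= K)%N ->
  X (K%:R^-1 *: \sum_(1 <= k < m.+1) v k).
Proof.
move=> cX X0 vX mK.
have avg : X (m%:R^-1 *: \sum_(1 <= k < m.+1) v k).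
  elim: m mK => [|m IH] mK; first by rewrite big_nil scaler0.
  have {}IH := IH (ltnW mK).
  set y := \sum_(_ <= _ < m.+1) _ in IH.
  have m1 : 0 <= (m.+1%:R^-1 : R) <= 1.
    by rewrite invr_ge0 ler0n /= invf_le1 ?ler1n ?ltr0n.
  have := convex_set_segment cX IH (vX m.+1 mK) m1.
  rewrite big_nat_recr //= -/y; congr X.
  rewrite scalerBr [RHS]scalerDr addrCA addrC; congr (_ + _).
  rewrite scalerA -scalerBl; have [m0|m0] := posnP m.
    by rewrite /y m0 big_nil !scaler0.
  by congr (_ *: _); field; rewrite nat1r !pnatr_eq0 /= -lt0n m0.
have [m0|m0] := posnP m; first by rewrite m0 big_nil scaler0.
have K0 : (0 < K)%N := leq_trans m0 mK.
have mK1 : 0 <= (m%:R / K%:R : R) <= 1.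
  by rewrite divr_ge0 //= ler_pdivrMr ?ltr0n // mul1r ler_nat.
have := convex_set_segment cX X0 avg mK1; rewrite add0r subr0 scalerA.
by rewrite mulrAC mulfV ?pnatr_eq0 -?lt0n // mul1r.
Qed.

Section run.
Variables (R : realType) (n : nat) (X : set 'rV[R]_n) (T K : nat).
Variables (B mu beta L : R) (gamma : nat -> R) (v1 : nat -> 'rV[R]_n).
Variables (f : nat -> 'rV[R]_n -> R) (gradf : nat -> 'rV[R]_n -> 'rV[R]_n).
Variables (p : nat -> 'rV[R]_n) (x v : nat -> nat -> 'rV[R]_n) (lambda : nat -> R).
Hypothesis HX : decision_set X.
Hypothesis T0 : (0 < T)%N.
Hypothesis K0 : (0 < K)%N.
Hypothesis B0 : 0 < B.
Hypothesis mu0 : 0 < mu.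
Hypothesis beta0 : 0 < beta.
Hypothesis L0 : 0 <= L.
Hypothesis Hf : forall t, (1 <= t <= T)%N -> utility X beta L (f t) (gradf t).
Hypothesis gamma0 : forall t, (2 <= t <= T)%N -> 0 <= gamma t.
Hypothesis v1X : forall k, (1 <= k <= K)%N -> X (v1 k).
Hypothesis run : OLFW_run X T K B mu (beta ^+ 2) gamma v1 gradf p x v lambda.
Hypothesis pbeta : forall t, (1 <= t <= T)%N -> enorm (p t) <= beta.

Let diam := diameter X.
Let K0R : 0 < K%:R :> R. Proof. by rewrite ltr0n. Qed.
Let cX : convex_set X := decision_set_convex HX.
Let X0 : X 0 := decision_set_0 HX.

Lemma run_direction_in t k : (1 <= t <= T.+1)%N -> (1 <= k <= K)%N -> X (v t k).
Proof.
case: t => // -[|t] tT kK.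
  by rewrite (OLFW_direction_init run kK); exact: v1X.
by have [] := OLFW_direction_step run (t := t.+1) tT kK.
Qed.

Lemma run_iterateE t m : (1 <= t <= T)%N -> (m <= K)%N ->
  x t m.+1 = K%:R^-1 *: \sum_(1 <= k < m.+1) v t k.
Proof.
move=> tT; elim: m => [|m IH] mK.
  by rewrite (OLFW_iterate_init run tT) big_nil scaler0.
rewrite (OLFW_iterate_step run tT (k := m.+1)) ?mK // IH ?(ltnW mK) //.
by rewrite [in RHS]big_nat_recr //= scalerDr.
Qed.

Lemma run_iterate_in t k : (1 <= t <= T)%N -> (1 <= k <= K.+1)%N -> X (x t k).
Proof.
case: k => // k tT; rewrite ltnS => kK; rewrite run_iterateE //.
refine (@convex_set_average _ _ X (v t) K k cX X0 _ kK) => j jK; apply: run_direction_in jK.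
by case/andP: tT => -> /leqW.
Qed.

Let dir_norm t k : (1 <= t <= T.+1)%N -> (1 <= k <= K)%N ->
  enorm (v t k) <= diam.
Proof.
move=> tT kK; rewrite -[v t k]subr0.
by apply: diameter_ge (decision_set_bounded HX) (run_direction_in tT kK) X0.
Qed.

Let T_T1 t : (1 <= t <= T)%N -> (1 <= t <= T.+1)%N.
Proof. by case/andP=> -> /leqW. Qed.

Lemma run_dual_ge0 t : (1 <= t <= T)%N -> 0 <= lambda t.
Proof.
case: t => // -[|t] tT; first by rewrite (OLFW_dual_init run).
rewrite (OLFW_dual run) // divr_ge0 ?le_max ?lexx ?orbT //.
by rewrite mulr_ge0 ?sqr_ge0 ?ltW.
Qed.

(* The dual variable is chosen so that the quadratic term of the Lagrangian
   cancels the growth of the squared gradients. *)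
Lemma run_dual_constraint t : (1 <= t <= T)%N ->
  beta ^+ 2 * mu * lambda t ^+ 2 + lambda t * (B / T%:R)
    <= lambda t * dotv (empirical_mean p t) (x t K.+1).
Proof.
case: t => // -[|t] tT; first by rewrite (OLFW_dual_init run) expr0n !(mul0r, mulr0) addr0.
have l0 := run_dual_ge0 tT.
have := OLFW_dual run (t := t.+2) tT; rewrite /surrogate_constraint.
set d := dotv _ _; have g0 : 0 <= gamma t.+2 by apply: gamma0.
have bm : beta ^+ 2 * mu != 0 by rewrite mulf_neq0 ?expf_neq0 ?gt_eqF.
move=> lE; have : beta ^+ 2 * mu * lambda t.+2 = Num.max (d - B / T%:R - gamma t.+2) 0.
  by rewrite lE mulrC divfK.
have [h|h] := leP (d - B / T%:R - gamma t.+2) 0 => E.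
  by move/eqP: E; rewrite mulf_eq0 (negbTE bm) => /= /eqP ->; rewrite expr0n !(mul0r, mulr0) addr0.
rewrite [lambda _ ^+ 2]expr2 mulrA E.
have : 0 <= lambda t.+2 * gamma t.+2 by rewrite mulr_ge0.
lra.
Qed.

(** Mean squared distance of the directions to the comparator 0; it telescopes over the rounds. *)
Definition run_potential t : R := K%:R^-1 * \sum_(1 <= k < K.+1) enorm (v t k) ^+ 2.

(** Smoothness bounds the scaled utility gain below by [<grad f, v>] minus a curvature term. The
    gradient step compared with 0 says that the Lagrangian payoff of [v] is nearly nonnegative,
    which trades [<grad f, v>] for [lambda] times the estimated cost of [v]. *)
Lemma run_frank_wolfe_step t k : (1 <= t <= T)%N -> (1 <= k <= K)%N ->
  lambda t * dotv (empirical_mean p t) (v t k)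
    - (enorm (v t k) ^+ 2 - enorm (v t.+1 k) ^+ 2) / (2 * mu)
    - mu * beta ^+ 2 * (1 + lambda t ^+ 2) - L * diam ^+ 2 / (2 * K%:R)
  <= K%:R * (f t (x t k.+1) - f t (x t k)).
Proof.
move=> tT kK.
have k1K : (1 <= k <= K.+1)%N by case/andP: kK => -> /leqW.
have Xv := run_direction_in (T_T1 tT) kK.
have Xx := run_iterate_in tT k1K.
have Xx1 : X (x t k.+1) by apply: run_iterate_in; case/andP: kK.
have fP := Hf tT.
have l0 := run_dual_ge0 tT.
have ph : enorm (empirical_mean p t) <= beta.
  apply: enorm_empirical_mean => [|s /andP[s1 st]]; first exact: ltW.
  by apply: pbeta; rewrite s1 (leq_trans (ltnW st)) //; case/andP: tT.
(* The utility contributes slope [beta] along differences of [X], and the empirical mean contributes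
   [lambda t * beta]. *)
have ogd : dotv (lagrangian_grad gradf p t (x t k) (lambda t)) (v t.+1 k - v t k)
    <= beta * (1 + lambda t) * enorm (v t.+1 k - v t k).
  have Xv1 : X (v t.+1 k) by apply: run_direction_in kK; case/andP: tT => _ tT; rewrite /= ltnS.
  have h1 := gradient_on_Lipschitz cX (utility_gradient fP)
    (utility_Lipschitz fP) Xx Xv1 Xv.
  rewrite /lagrangian_grad dotvBZl; set d := v t.+1 k - v t k in h1 *.
  have := dotv_le_enorm (empirical_mean p t) (- d); rewrite dotvNr enormN => h2.
  have h3 : enorm (empirical_mean p t) * enorm d <= beta * enorm d.
    by rewrite ler_wpM2r ?enorm_ge0.
  have : lambda t * - dotv (empirical_mean p t) d <= lambda t * (beta * enorm d).
    by rewrite ler_wpM2l // (le_trans h2).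
  lra.
have := online_gradient_step cX mu0 Xv X0 (OLFW_direction_step run tT kK) ogd.
rewrite !subr0 sub0r dotvNr /lagrangian_grad dotvBZl => ogs.
have step := OLFW_iterate_step run tT kK.
have vK : lev 0 (K%:R^-1 *: v t k).
  by move=> i; have := decision_set_ge0 HX Xv i; rewrite !mxE => ?; rewrite mulr_ge0 ?invr_ge0.
have sm : dotv (K%:R^-1 *: v t k) (gradf t (x t k))
    - L / 2 * enorm (K%:R^-1 *: v t k) ^+ 2 <= f t (x t k.+1) - f t (x t k).
  by rewrite step; apply: (utility_smooth fP) => //; [rewrite -step|left].
have eK : enorm (K%:R^-1 *: v t k) ^+ 2 = K%:R^-1 ^+ 2 * enorm (v t k) ^+ 2.
  by rewrite enormZ exprMn real_normK ?num_real.
rewrite dotvZl eK in sm.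
have vd : enorm (v t k) ^+ 2 <= diam ^+ 2.
  rewrite ler_pXn2r ?nnegrE ?enorm_ge0 ?dir_norm ?T_T1 //.
  by apply: le_trans (dir_norm (T_T1 tT) kK); exact: enorm_ge0.
rewrite -(ler_pM2l K0R) in sm; apply: le_trans sm.
rewrite mulrBr (mulrA _ K%:R^-1) mulfV ?gt_eqF // mul1r [dotv (v t k) _]dotvC.
have -> : K%:R * (L / 2 * (K%:R^-1 ^+ 2 * enorm (v t k) ^+ 2))
    = L * enorm (v t k) ^+ 2 / (2 * K%:R).
  by field; rewrite gt_eqF.
have : L * enorm (v t k) ^+ 2 / (2 * K%:R) <= L * diam ^+ 2 / (2 * K%:R).
  by rewrite ler_pM2r ?invr_gt0 ?mulr_gt0 // ler_wpM2l.
set a := dotv (gradf _ _) _ in ogs *; set b := dotv _ _ in ogs *.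
suff : lambda t * b - (enorm (v t k) ^+ 2 - enorm (v t.+1 k) ^+ 2) / (2 * mu) -
    mu * beta ^+ 2 * (1 + lambda t ^+ 2) <= a by lra.
rewrite -(ler_pM2l (_ : 0 < 2 * mu)) ?mulr_gt0 //.
have -> : 2 * mu * (lambda t * b
    - (enorm (v t k) ^+ 2 - enorm (v t.+1 k) ^+ 2) / (2 * mu)
    - mu * beta ^+ 2 * (1 + lambda t ^+ 2)) = 2 * mu * (lambda t * b)
    - (enorm (v t k) ^+ 2 - enorm (v t.+1 k) ^+ 2)
    - mu ^+ 2 * (2 * beta ^+ 2 * (1 + lambda t ^+ 2)).
  by field; rewrite gt_eqF.
(* Since [(1 + lambda)^2 <= 2 (1 + lambda^2)], the dual variable enters only through its square,
   with the coefficient that [run_dual_constraint] cancels exactly. *)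
have : mu ^+ 2 * (beta * (1 + lambda t)) ^+ 2
    <= mu ^+ 2 * (2 * beta ^+ 2 * (1 + lambda t ^+ 2)).
  rewrite ler_wpM2l ?sqr_ge0 // exprMn -[leRHS]mulrA [leRHS]mulrCA ler_wpM2l ?sqr_ge0 //.
  by have := sqr_ge0 (1 - lambda t); rewrite sqrrB sqrrD expr1n; lra.
move: ogs; lra.
Qed.

(** Over [k] the utility gains telescope from [f t 0 = 0], while the directions average to the point
    played, so their estimated costs reassemble into the one bounded below by
    [run_dual_constraint]. *)
Lemma run_dual_step t : (1 <= t <= T)%N ->
  lambda t * (B / T%:R)
    <= f t (x t K.+1) + (run_potential t - run_potential t.+1) / (2 * mu)
       + mu * beta ^+ 2 + L * diam ^+ 2 / (2 * K%:R).
Proof.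
move=> tT; have := run_dual_constraint tT.
set c := mu * beta ^+ 2 * (1 + lambda t ^+ 2); set q := L * diam ^+ 2 / _.
have : \sum_(1 <= k < K.+1) (lambda t * dotv (empirical_mean p t) (v t k)
    - (enorm (v t k) ^+ 2 - enorm (v t.+1 k) ^+ 2) / (2 * mu) - c - q)
  <= \sum_(1 <= k < K.+1) K%:R * (f t (x t k.+1) - f t (x t k)).
  by apply: ler_sum_nat => k kK; apply: run_frank_wolfe_step.
rewrite -[leRHS]mulr_sumr telescope_sumr // (OLFW_iterate_init run tT).
rewrite (utility_normalized (Hf tT)) subr0 !big_split /= !sumrN.
rewrite !sumr_const_nat subn1 -[c *+ _]mulr_natl -[q *+ _]mulr_natl.
rewrite -mulr_suml -mulr_sumr -dotv_sumr sumrB.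
rewrite run_iterateE // dotvZr.
set P := \sum_(_ <= _ < _) v t _; set V := \sum_(_ <= _ < _) enorm (v t _) ^+ 2.
set V' := \sum_(_ <= _ < _) enorm (v t.+1 _) ^+ 2.
rewrite /run_potential -/V -/V' => h1 h2.
rewrite -(ler_pM2l K0R) in h2; rewrite -(ler_pM2l K0R).
have e1 : K%:R * (lambda t * (K%:R^-1 * dotv (empirical_mean p t) P))
   = lambda t * dotv (empirical_mean p t) P by field; rewrite gt_eqF.
have e2 : K%:R * (f t (K%:R^-1 *: P) + (K%:R^-1 * V - K%:R^-1 * V') / (2 * mu)
    + mu * beta ^+ 2 + q) = K%:R * f t (K%:R^-1 *: P) + (V - V') / (2 * mu)
    + K%:R * (mu * beta ^+ 2) + K%:R * q by field; rewrite !gt_eqF.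
move: h1; rewrite e2.
move: h2; rewrite e1 /c !mulrDr; lra.
Qed.

Lemma run_dual_sum (F : R) :
  (forall t, (1 <= t <= T)%N -> f t (x t K.+1) <= F) ->
  (\sum_(1 <= t < T.+1) lambda t) * (B / T%:R)
    <= T%:R * (F + mu * beta ^+ 2 + L * diam ^+ 2 / (2 * K%:R))
       + diam ^+ 2 / (2 * mu).
Proof.
move=> FF; rewrite mulr_suml.
have := @ler_sum_nat _ 1 T.+1 _ _ (fun t tT => le_trans (run_dual_step tT)
  (lerD (lerD (lerD (FF t tT) (lexx _)) (lexx _)) (lexx _))).
move=> /le_trans; apply.
rewrite !big_split /= -mulr_suml !sumr_const_nat subn1.
rewrite -[F *+ T]mulr_natl -[(mu * _) *+ T]mulr_natl -[(L * _ / _) *+ T]mulr_natl.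
have -> : \sum_(1 <= t < T.+1) (run_potential t - run_potential t.+1)
    = run_potential 1 - run_potential T.+1.
  rewrite -[RHS]opprB -telescope_sumr // -sumrN.
  by apply: eq_bigr => ? _; rewrite opprB.
have d0 : 0 <= diam.
  by apply: le_trans (diameter_ge (decision_set_bounded HX) X0 X0); exact: enorm_ge0.
have P1 : run_potential 1 <= diam ^+ 2.
  rewrite /run_potential mulrC ler_pdivrMr //.
  apply: (@le_trans _ _ (\sum_(1 <= k < K.+1) diam ^+ 2)).
    by apply: ler_sum_nat => k kK; rewrite ler_pXn2r ?nnegrE ?enorm_ge0 ?dir_norm.
  by rewrite sumr_const_nat subn1 mulr_natr.
have P2 : 0 <= run_potential T.+1.
  by rewrite mulr_ge0 ?invr_ge0 ?(ltW K0R) // sumr_ge0 // => k _; rewrite sqr_ge0.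
have : (run_potential 1 - run_potential T.+1) / (2 * mu) <= diam ^+ 2 / (2 * mu).
  by rewrite ler_pM2r ?invr_gt0 ?mulr_gt0 //; lra.
rewrite !mulrDr; lra.
Qed.

Lemma run_surrogate_sum (F : R) : 0 < diam ->
  mu = diam / (beta * Num.sqrt T%:R) -> K%:R = Num.sqrt T%:R :> R ->
  (forall t, (1 <= t <= T)%N -> f t (x t K.+1) <= F) ->
  \sum_(2 <= t < T.+1) surrogate_constraint T B gamma p t (x t K.+1)
    <= T%:R / B * diam * beta * F * Num.sqrt T%:R
       + T%:R * diam * beta / B * (L * diam ^+ 2 / 2 + 2 * diam * beta).
Proof.
move=> d0 muE KE FF.
have TE : T%:R = K%:R ^+ 2 :> R by rewrite KE sqr_sqrtr.
have bmu : 0 < beta ^+ 2 * mu by rewrite mulr_gt0 ?exprn_gt0.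
(* For [t >= 2], [beta ^+ 2 * mu * lambda t] is the positive part of the surrogate, and
   [lambda 1 = 0]. *)
apply: (@le_trans _ _ (beta ^+ 2 * mu * \sum_(1 <= t < T.+1) lambda t)).
  rewrite [X in _ <= _ * X]big_ltn // (OLFW_dual_init run) add0r mulr_sumr.
  apply: ler_sum_nat => t tT; rewrite (OLFW_dual run) //.
  by rewrite mulrC divfK ?gt_eqF // le_max lexx.
have := run_dual_sum FF.
set S := \sum_(_ <= _ < _) _ => hS.
have T0R : 0 < T%:R :> R by rewrite ltr0n.
rewrite mulrA ler_pdivrMr // in hS.
rewrite -(ler_pM2r B0); apply: (@le_trans _ _ (beta ^+ 2 * mu * (S * B))).
  by rewrite mulrA.
apply: (@le_trans _ _ (beta ^+ 2 * mu * ((T%:R *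
    (F + mu * beta ^+ 2 + L * diam ^+ 2 / (2 * K%:R)) + diam ^+ 2 / (2 * mu)) * T%:R))).
  by rewrite ler_pM2l.
rewrite muE -KE TE.
(* The [3 / 2] is 1 from the squared gradients plus 1/2 from the initial potential; the stated bound
   allows 2. *)
have -> : beta ^+ 2 * (diam / (beta * K%:R)) * ((K%:R ^+ 2 *
    (F + diam / (beta * K%:R) * beta ^+ 2 + L * diam ^+ 2 / (2 * K%:R)) +
    diam ^+ 2 / (2 * (diam / (beta * K%:R)))) * K%:R ^+ 2) =
  K%:R ^+ 2 * diam * beta * (F * K%:R + L * diam ^+ 2 / 2 + 3 / 2 * diam * beta).
  by field; rewrite !gt_eqF.
have -> : (K%:R ^+ 2 / B * diam * beta * F * K%:R + K%:R ^+ 2 * diam * beta / B *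
      (L * diam ^+ 2 / 2 + 2 * diam * beta)) * B =
  K%:R ^+ 2 * diam * beta * (F * K%:R + L * diam ^+ 2 / 2 + 2 * diam * beta).
  by field; rewrite gt_eqF.
rewrite ler_pM2l ?mulr_gt0 ?exprn_gt0 //.
have : 0 < diam * beta by rewrite mulr_gt0.
lra.
Qed.

End run.

(** Adding the smoothness inequalities from 0 up to [u] and from [u] back to 0 gives
    [<u, g 0 - g u> <= L |u|^2], and DR-submodularity makes the left side nonnegative. A nonzero [u]
    exists because the diameter is positive. *)
Lemma utility_smooth_ge0 (R : realType) (n : nat) (X : set 'rV[R]_n) (b L : R) f g :
  decision_set X -> 0 < diameter X -> utility X b L f g -> 0 <= L.
Proof.
move=> HX d0 fP; have X0 := decision_set_0 HX.
have [u Xu u0] : exists2 u, X u & u != 0.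
  apply: contrapT => H; move: d0; rewrite lt_neqAle => /andP[/eqP + _]; apply.
  suff -> : diameter X = sup [set 0] by rewrite sup1.
  have X0E z : X z -> z = 0.
    by move=> Xz; apply: contrapT => /eqP z0; apply: H; exists z.
  congr sup; apply/seteqP; split=> [_ [[y z] [/= /X0E -> /X0E ->] <-]|_ ->] /=.
    by rewrite subrr enorm0.
  by exists (0, 0) => //=; rewrite subrr enorm0.
have u_ge0 := decision_set_ge0 HX Xu.
have q0 : 0 < enorm u ^+ 2 by rewrite exprn_gt0 // lt_def enorm_eq0 u0 enorm_ge0.
have h1 : dotv u (g 0) - L / 2 * enorm u ^+ 2 <= f (0 + u) - f 0.
  by apply: (utility_smooth fP) => //; [rewrite add0r|left].
have h2 : dotv (- u) (g u) - L / 2 * enorm (- u) ^+ 2 <= f (u - u) - f u.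
  apply: (utility_smooth fP) => //; [by rewrite subrr|right=> i].
  by move: (u_ge0 i); rewrite !mxE oppr_le0.
have h3 : dotv u (g u) <= dotv u (g 0).
  rewrite -subr_ge0 -dotvBr; apply: dotv_ge0 => // i; rewrite !mxE subr_ge0.
  exact: (utility_DR_submodular fP Xu X0 u_ge0).
rewrite add0r in h1; rewrite subrr enormN dotvNl in h2.
rewrite leNgt; apply/negP => Lneg.
have : L * enorm u ^+ 2 < 0 by rewrite nmulr_rlt0.
lra.
Qed.

(** * Borel sets of row vectors *)

Section borel.
Variables (R : realType) (n : nat).

(** Balls of the sup norm are boxes: with rational data they form a countable base of the topology
    whose preimages split into coordinate events. *)
Definition rat_box (qr : 'rV[rat]_n * rat) : set 'rV[R]_n :=
  ball (map_mx (@ratr R) qr.1) (ratr qr.2).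

Lemma open_rat_boxes (U : set 'rV[R]_n) : open U ->
  U = \bigcup_(qr in [set qr | rat_box qr `<=` U]) rat_box qr.
Proof.
move=> oU; apply/seteqP; split=> [x Ux|x [qr /= qrU] /qrU //].
have /nbhs_ballP[e /= e0 eU] := open_nbhs_nbhs (conj oU Ux).
have [|r /[!in_itv] /= /andP[r0 re]] := @rat_in_itvoo R (e / 4) (e / 2); first lra.
have r_gt0 : 0 < ratr r :> R by apply: lt_trans r0; rewrite divr_gt0.
have qP i : exists q : rat, `|ratr q - x 0 i| < ratr r.
  have [|q /[!in_itv] /= /andP[q0 q1]] :=
    @rat_in_itvoo R (x 0 i - ratr r) (x 0 i + ratr r); first lra.
  by exists q; rewrite ltr_norml; lra.
have [q qE] := choice qP.
have xq : ball (map_mx (@ratr R) (\row_i q i)) (ratr r) x.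
  split=> // i j; rewrite !mxE ord1 -ball_normE /ball_ /=; exact: qE.
exists (\row_i q i, r) => //= y yq; apply: eU.
apply: (@le_ball _ _ _ (ratr r + ratr r)); first lra.
by apply: ball_triangle yq; apply: ball_sym.
Qed.

Lemma measurable_rV d (T : measurableType d) (f : T -> borel_rV R n) :
  (forall i, measurable_fun setT (fun w => (f w : 'rV[R]_n) 0 i)) ->
  measurable_fun setT f.
Proof.
move=> mf; apply: (@measurability _ _ T (borel_rV R n) setT f (@open 'rV[R]_n)) => // _ [U oU <-].
rewrite setTI (open_rat_boxes oU) preimage_bigcup bigcup_mkcond.
apply: countable_bigcupT_measurable => // qr; case: ifP => // _.
rewrite /rat_box.
(* A matrix ball of nonpositive radius is empty, which the intersection over coordinates would miss
   when [n = 0]. *)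
have [r0|r0] := ltP 0 (ratr qr.2 : R); last first.
  by rewrite (_ : _ @^-1` _ = set0) // -subset0 => w [/lt_le_trans /(_ r0)]; rewrite ltxx.
rewrite (_ : _ @^-1` _ = \bigcap_(i : 'I_n)
    ((fun w => (f w : 'rV[R]_n) 0 i) @^-1` ball (ratr (qr.1 0 i) : R) (ratr qr.2))).
  apply: fin_bigcap_measurable => // i _; rewrite -[X in measurable X]setTI.
  by apply: mf => //; exact: measurable_ball.
apply/seteqP; split=> w /=.
  by move=> [_ h] i _; have := h 0 i; rewrite mxE.
by move=> h; split=> // i j; rewrite ord1 mxE; exact: h.
Qed.

Lemma measurable_coord i : measurable_fun setT (fun v : borel_rV R n => (v : 'rV[R]_n) 0 i).
Proof.
apply: (@measurability _ _ (borel_rV R n) R setT _ _ (RGenOpens.measurableE R)).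
move=> _ [_ [a [b ->]] <-].
have : open `]a, b[%classic by exact: interval_open.
rewrite setTI => oU; apply: sub_sigma_algebra; move: oU.
by move/continuousP : (@coord_continuous R 1 n 0 i); exact.
Qed.
End borel.

Section borel_vectors.
Variables (R : realType) (n : nat).

Lemma measurable_sumr d (T : measurableType d) (I : Type) (r : seq I)
    (h : I -> T -> R) : (forall i, measurable_fun setT (h i)) ->
  measurable_fun setT (fun w => \sum_(i <- r) h i w).
Proof.
move=> mh; elim: r => [|i r IH].
  by under eq_fun do rewrite big_nil; exact: measurable_cst.
by under eq_fun do rewrite big_cons; exact: measurable_funD.
Qed.

Lemma measurable_rVP d (T : measurableType d) (f : T -> borel_rV R n) i :
  measurable_fun setT f -> measurable_fun setT (fun w => (f w : 'rV[R]_n) 0 i).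
Proof. by move=> mf; exact: measurableT_comp (measurable_coord i) mf. Qed.

Lemma measurable_dotv d (T : measurableType d) (f g : T -> borel_rV R n) :
  measurable_fun setT f -> measurable_fun setT g ->
  measurable_fun setT (fun w => dotv (f w : 'rV[R]_n) (g w)).
Proof.
move=> mf mg; rewrite /dotv; apply: measurable_sumr => i.
by apply: measurable_funM; exact: measurable_rVP.
Qed.

Lemma measurable_addv d (T : measurableType d) (f g : T -> borel_rV R n) :
  measurable_fun setT f -> measurable_fun setT g ->
  measurable_fun setT (fun w => (f w : 'rV[R]_n) + g w : borel_rV R n).
Proof.
move=> mf mg; apply: measurable_rV => i.
by under eq_fun do rewrite mxE; apply: measurable_funD; exact: measurable_rVP.
Qed.

Lemma measurable_enorm d (T : measurableType d) (f : T -> borel_rV R n) :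
  measurable_fun setT f -> measurable_fun setT (fun w => enorm (f w : 'rV[R]_n)).
Proof.
move=> mf.
exact: (measurableT_comp (continuous_measurable_fun (@sqrt_continuous R))
  (measurable_dotv mf mf)).
Qed.

Lemma measurable_enorm_ge d (T : measurableType d) (f : T -> borel_rV R n) r :
  measurable_fun setT f -> measurable [set w | r <= enorm (f w : 'rV[R]_n)].
Proof.
move=> mf; rewrite (_ : mkset _ = (fun w => enorm (f w : 'rV[R]_n)) @^-1` `[r, +oo[).
  by rewrite -[X in measurable X]setTI; exact: measurable_enorm.
by apply/seteqP; split=> w /=; rewrite in_itv /= andbT.
Qed.

Lemma measurable_enorm_gt d (T : measurableType d) (f : T -> borel_rV R n) r :
  measurable_fun setT f -> measurable [set w | r < enorm (f w : 'rV[R]_n)].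
Proof.
move=> mf; rewrite (_ : mkset _ = (fun w => enorm (f w : 'rV[R]_n)) @^-1` `]r, +oo[).
  by rewrite -[X in measurable X]setTI; exact: measurable_enorm.
by apply/seteqP; split=> w /=; rewrite in_itv /= andbT.
Qed.

(** A point outside the support has a null open neighborhood, hence lies in a null rational box.
    There are countably many boxes; [F] enumerates the null ones by their codes and is empty at all
    other codes. *)
Lemma negligible_not_support (D : probability (borel_rV R n) R) :
  D.-negligible (~` prob_support D).
Proof.
pose F k : set (borel_rV R n) := if unpickle k is Some qr then
  if D (@rat_box R n qr) == 0%E then @rat_box R n qr else set0 else set0.
have nF k : D.-negligible (F k).
  rewrite /F; case: unpickle => [qr|]; last exact: negligible_set0.
  case: eqP => [D0|_]; last exact: negligible_set0.
  exists (@rat_box R n qr); split => //.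
  have [r0|r0] := ltP 0 (ratr qr.2 : R).
    by apply: sub_sigma_algebra; exact: ball_open.
  by rewrite (_ : @rat_box R n qr = set0) // -subset0 => w [/lt_le_trans /(_ r0)]; rewrite ltxx.
apply: negligibleS (negligible_bigcup nF) => x.
move=> /existsNP[U /not_implyP[oU /not_implyP[Ux /negP]]].
rewrite -leNgt measure_le0 => /eqP DU.
have := Ux; rewrite {1}(open_rat_boxes oU) => -[qr /= qrU xqr].
exists (pickle qr) => //; rewrite /F pickleK.
suff -> : D (@rat_box R n qr) = 0%E by rewrite eqxx.
have oqr : open (@rat_box R n qr).
  by apply: ball_open; case: xqr.
apply/eqP; rewrite -measure_le0 -DU.
by apply: le_measure => //; rewrite inE; apply: sub_sigma_algebra.
Qed.

End borel_vectors.

(* For y <= 1/2, [expR y <= 1 + y + 2 * y ^+ 2] because [expR (- y) >= 1 - y]. *)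
Lemma expR_le_quad (R : realType) (y : R) : expR y <= y + expR (2 * y ^+ 2).
Proof.
have [y2|y2] := leP y (1 / 2).
  have h : expR y * (1 - y) <= 1.
    have := expR_ge1Dx (- y) => h.
    by rewrite -[X in _ <= X](expRxMexpNx_1 y) ler_pM2l ?expR_gt0.
  have y1 : 0 < 1 - y by lra.
  have h2 : expR y <= 1 + y + 2 * y ^+ 2.
    rewrite -(ler_pM2r y1); apply: (le_trans h).
    have := sqr_ge0 y; nra.
  apply: (le_trans h2); rewrite -addrA addrCA lerD2l.
  exact: expR_ge1Dx.
(* Here [y > 1 / 2], so already [y <= 2 * y ^+ 2]. *)
apply: (@le_trans _ _ (expR (2 * y ^+ 2))); last by rewrite lerDr; lra.
rewrite ler_expR expr2; nra.
Qed.

(** * Concentration of sums of bounded independent vectors *)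

Lemma ae_imply d (T : measurableType d) (R : realType)
    (mu : {measure set T -> \bar R}) (P Q : T -> Prop) :
  (forall x, P x -> Q x) -> (\forall x \ae mu, P x) -> \forall x \ae mu, Q x.
Proof. by move=> PQ; apply: filterS. Qed.

Lemma measurable_expR_comp d (T : measurableType d) (R : realType) (h : T -> R) :
  measurable_fun setT h -> measurable_fun setT (fun w => expR (h w)).
Proof. by move=> mh; exact: (measurableT_comp (@measurable_expR R) mh). Qed.

Section moment_generating_function.
Variables (R : realType) (n : nat) (D : probability (borel_rV R n) R).
Let m : 'rV[R]_n := mean_vector D.

Variable b : R.
Hypothesis D_bounded : \forall v \ae D, enorm ((v : 'rV[R]_n) - m) <= b.

Lemma ae_bounded_integrable (g : borel_rV R n -> R) (M : R) :
  measurable_fun setT g -> (\forall v \ae D, `|g v| <= M) ->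
  D.-integrable setT (EFin \o g).
Proof.
move=> mg gM; apply/integrableP; split; first exact/measurable_EFinP.
apply: (@le_lt_trans _ _ (`|M|%:E * D setT)%E).
  apply: integral_le_bound => //; first exact/measurable_EFinP.
  by apply: ae_imply gM => v h _; rewrite lee_fin (le_trans h) ?ler_norm.
by rewrite probability_setT mule1 ltry.
Qed.

Lemma coord_integrable i :
  D.-integrable setT (EFin \o (fun v : borel_rV R n => (v : 'rV[R]_n) 0 i)).
Proof.
apply: (@ae_bounded_integrable _ (b + enorm m)); first exact: measurable_coord.
apply: ae_imply D_bounded => v h; apply: le_trans (enorm_coord _ _) _.
by rewrite -[v in enorm v](subrK m) (le_trans (ler_enormD _ _)) // lerD2r.
Qed.

Lemma integral_centered_dotv (s : 'rV[R]_n) :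
  (\int[D]_v (dotv s ((v : 'rV[R]_n) - m))%:E = 0)%E.
Proof.
have cI i : D.-integrable setT (fun v : borel_rV R n => (s 0 i * ((v : 'rV[R]_n) 0 i - m 0 i))%:E).
  rewrite (_ : (fun _ => _) =
    fun v => (s 0 i)%:E * (((v : 'rV[R]_n) 0 i)%:E - (m 0 i)%:E))%E; last first.
    by apply/funext => v; rewrite EFinM EFinB.
  apply: integrableZl => //; apply: integrableB => //; first exact: coord_integrable.
  exact: finite_measure_integrable_cst.
under eq_integral => v _.
  rewrite /dotv -sumEFin; under eq_bigr do rewrite mxE [in X in _ + X]mxE; over.
rewrite integral_sum // big1 // => i _.
have cI' := coord_integrable i.
transitivity ((s 0 i)%:E * (\int[D]_v (((v : 'rV[R]_n) 0 i)%:E - (m 0 i)%:E)))%E.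
  rewrite -integralZl //; apply: integrableB => //.
  exact: finite_measure_integrable_cst.
rewrite integralB //; last exact: finite_measure_integrable_cst.
have mE : (\int[D]__ (m 0 i)%:E = (m 0 i)%:E)%E.
  rewrite integral_cst // -[RHS]mule1; congr (_ * _)%E; exact: probability_setT.
rewrite mE /m /mean_vector mxE /Rintegral.
by rewrite fineK ?subee ?mule0 //; exact: integrable_fin_num.
Qed.

Let measurable_centered :
  measurable_fun setT (fun v : borel_rV R n => (v : 'rV[R]_n) - m : borel_rV R n).
Proof. by apply: measurable_addv => //; exact: measurable_cst. Qed.

(** In [expR_le_quad] the linear term integrates to 0 and the other is almost surely bounded: a
    Hoeffding-type bound, with 2 in place of the sharp 1/2. *)
Lemma mgf_centered_dotv (s : 'rV[R]_n) :
  (\int[D]_v (expR (dotv s ((v : 'rV[R]_n) - m)))%:E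
    <= (expR (2 * (enorm s * b) ^+ 2))%:E)%E.
Proof.
set g := fun v : borel_rV R n => dotv s ((v : 'rV[R]_n) - m).
have mg : measurable_fun setT g.
  by apply: measurable_dotv; [exact: measurable_cst|exact: measurable_centered].
set c := expR _.
have gb : \forall v \ae D, `|g v| <= enorm s * b.
  apply: ae_imply D_bounded => v h.
  apply: (@le_trans _ _ (enorm s * enorm ((v : 'rV[R]_n) - m))).
    rewrite ler_norml dotv_le_enorm andbT lerNl -dotvNr.
    by rewrite (le_trans (dotv_le_enorm _ _)) // enormN.
  by rewrite ler_wpM2l ?enorm_ge0.
have mh : measurable_fun setT (fun v => expR (2 * g v ^+ 2)).
  apply: measurable_expR_comp; apply: measurable_funM => //.
  exact: measurable_funX.
have hc : \forall v \ae D, `|expR (2 * g v ^+ 2)| <= c.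
  apply: ae_imply gb => v h; rewrite ger0_norm ?expR_ge0 // ler_expR ler_pM2l //.
  by rewrite -(real_normK (num_real (g v))) ler_pXn2r ?nnegrE ?(le_trans _ h).
have gI := ae_bounded_integrable mg gb.
have hI := ae_bounded_integrable mh hc.
apply: (@le_trans _ _ (\int[D]_v ((g v)%:E + (expR (2 * g v ^+ 2))%:E))%E).
  apply: ge0_le_integral => //.
  - by apply/measurable_EFinP; exact: measurable_expR_comp.
  - by apply/measurable_EFinP; exact: measurable_funD.
  - by move=> v _; rewrite lee_fin expR_le_quad.
rewrite integralD // [X in (X + _)%E]integral_centered_dotv add0e.
apply: (@le_trans _ _ (\int[D]_(v in setT) cst c%:E v)%E).
  apply: ae_ge0_le_integral => //.
  - exact/measurable_EFinP.
  - by move=> v _; rewrite /= lee_fin expR_ge0.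
  - by apply: ae_imply hc => v h _; rewrite lee_fin (le_trans (ler_norm _)).
rewrite integral_cst // -[leRHS]mule1 lee_pmul2l ?lte_fin ?expR_gt0 //.
exact: probability_le1.
Qed.

(* Conditionally on the first summand, the cross term of the squared norm is
   centered and bounded. *)
Lemma mgf_sqr_enorm_step (Q : probability (borel_rV R n) R) (theta : R) :
  0 <= theta ->
  (\int[Q \x D]_z (expR (theta * enorm ((z.1 : 'rV[R]_n) + ((z.2 : 'rV[R]_n) - m)) ^+ 2))%:E
    <= (expR (theta * b ^+ 2))%:E *
       \int[Q]_s (expR (theta * (1 + 8 * theta * b ^+ 2) * enorm (s : 'rV[R]_n) ^+ 2))%:E)%E.
Proof.
move=> theta0.
have mexp d (T : measurableType d) (h : T -> borel_rV R n) (a : R) :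
    measurable_fun setT h ->
    measurable_fun setT (fun w => (expR (a * enorm (h w : 'rV[R]_n) ^+ 2))%:E).
  move=> mh; apply/measurable_EFinP; apply: measurable_expR_comp.
  apply: measurable_funM => //; apply: measurable_funX; exact: measurable_enorm.
have msum : measurable_fun setT (fun z : borel_rV R n * borel_rV R n =>
    (z.1 : 'rV[R]_n) + ((z.2 : 'rV[R]_n) - m) : borel_rV R n).
  apply: measurable_addv => //.
  exact: (measurableT_comp measurable_centered measurable_snd).
rewrite fubini_tonelli1 /=; last 2 first.
- exact: mexp msum.
- by move=> z; rewrite lee_fin expR_ge0.
rewrite -ge0_integralZl //; last first.
  by apply: mexp; exact: measurable_id.
apply: ge0_le_integral => //.
- by move=> s _; apply: integral_ge0 => v _; rewrite lee_fin expR_ge0.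
- by apply: measurable_fun_fubini_tonelli_F; [exact: mexp msum|move=> z; rewrite lee_fin expR_ge0].
- by apply: measurable_funeM; apply: mexp; exact: measurable_id.
move=> s _; rewrite /fubini_F /=.
set k := theta * b ^+ 2 + theta * enorm (s : 'rV[R]_n) ^+ 2.
(* The cross term is [dotv t (v - m)]; its factor [2 * (enorm t * b) ^+ 2 = 8 * theta ^+ 2 * b ^+ 2
   * enorm s ^+ 2] is the source of the 8. *)
set t := (2 * theta) *: (s : 'rV[R]_n).
have mt : measurable_fun setT (fun v : borel_rV R n => (expR (dotv t ((v : 'rV[R]_n) - m)))%:E).
  apply/measurable_EFinP; apply: measurable_expR_comp; apply: measurable_dotv => //.
apply: (@le_trans _ _ (\int[D]_v ((expR k)%:E * (expR (dotv t ((v : 'rV[R]_n) - m)))%:E))%E).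
  apply: ae_ge0_le_integral => //.
  - apply: mexp; apply: measurable_addv => //; exact: measurable_cst.
  - exact: measurable_funeM.
  apply: ae_imply D_bounded => v h _; rewrite -EFinM lee_fin -expRD ler_expR.
  set u := (v : 'rV[R]_n) - m in h *.  clearbody u.
  have u2 : theta * enorm u ^+ 2 <= theta * b ^+ 2.
    rewrite ler_wpM2l // ler_pXn2r ?nnegrE ?enorm_ge0 ?(le_trans _ h) ?enorm_ge0 //.
  rewrite sqr_enorm dotvDr !dotvDl -!sqr_enorm /t dotvZl (dotvC u) /k.
  lra.
rewrite ge0_integralZl //.
apply: (@le_trans _ _ ((expR k)%:E * (expR (2 * (enorm t * b) ^+ 2))%:E)%E).
  by rewrite lee_pmul2l ?lte_fin ?expR_gt0 // mgf_centered_dotv.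
rewrite -!EFinM lee_fin -!expRD ler_expR /k /t enormZ.
by rewrite ger0_norm ?mulr_ge0 // !exprMn; lra.
Qed.

End moment_generating_function.

(** When [P N] is positive, the left side divided by [P N] is a measure in [W] that agrees with the
    product on rectangles, so uniqueness of product measures applies. The event [N] carries the
    later samples through the induction below. *)
Lemma independent_joint_law d d1 d2 (Omega : measurableType d)
    (T1 : measurableType d1) (T2 : measurableType d2) (R : realType)
    (P : probability Omega R) (S : {mfun Omega >-> T1}) (X : {mfun Omega >-> T2})
    (N : set Omega) : measurable N ->
  (forall A B, measurable A -> measurable B ->
    P (S @^-1` A `&` (X @^-1` B `&` N)) = (P (S @^-1` A) * (P (X @^-1` B) * P N))%E) ->
  forall W, measurable W ->
    P ((fun w => (S w, X w)) @^-1` W `&` N)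
      = ((distribution P S \x distribution P X)%E W * P N)%E.
Proof.
move=> mN indep W mW.
have mSX : measurable_fun setT (fun w => (S w, X w)) by exact: measurable_fun_pair.
have mpre V : measurable V -> measurable ((fun w => (S w, X w)) @^-1` V).
  by move=> mV; rewrite -[X in measurable X]setTI; exact: mSX.
have PNfin : P N \is a fin_num by exact: fin_num_measure.
have [PN0|PN0] := eqVneq (P N) 0%E.
  rewrite PN0 mule0; apply/eqP; rewrite -measure_le0 -PN0.
  by apply: le_measure; rewrite ?inE //; apply: measurableI => //; exact: mpre.
have c0 : 0 <= (fine (P N))^-1 by rewrite invr_ge0 fine_ge0.
have cN : (((fine (P N))^-1)%:E * P N = 1)%E.
  have PNE : P N = (fine (P N))%:E by rewrite fineK.
  by rewrite [X in (_ * X)%E]PNE -EFinM mulVf // fine_eq0.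
pose m0 : {measure set (T1 * T2) -> \bar R} := mscale (NngNum c0)
  (pushforward (mrestr P mN) (fun w => (S w, X w))).
pose m' := m0 mSX.
have m'E (V : set (T1 * T2)) :
  m' V = (((fine (P N))^-1)%:E * P ((fun w => (S w, X w)) @^-1` V `&` N))%E by [].
rewrite (@product_measure_unique _ _ _ _ _ _ _ m') ?m'E //.
  by rewrite muleAC cN mul1e.
move=> A B mA mB; rewrite m'E.
rewrite (_ : _ @^-1` _ = S @^-1` A `&` X @^-1` B) // -setIA indep //.
by rewrite muleCA; congr (_ * _)%E; rewrite muleCA cN mule1.
Qed.

Section random_walk.
Variables (R : realType) (n T : nat) (D : probability (borel_rV R n) R).
Variables (d : measure_display) (Omega : measurableType d).
Variables (P : probability Omega R) (p : nat -> {RV P >-> borel_rV R n}).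
Let m : 'rV[R]_n := mean_vector D.
Hypothesis p_iid : iid T D p.

Definition centered_sum k : Omega -> borel_rV R n :=
  fun w => \sum_(1 <= s < k.+1) ((p s w : 'rV[R]_n) - m).

Lemma centered_sumS k w :
  centered_sum k.+1 w = centered_sum k w + ((p k.+1 w : 'rV[R]_n) - m).
Proof. by rewrite /centered_sum big_nat_recr. Qed.

Lemma measurable_centered_sum k : measurable_fun setT (centered_sum k).
Proof.
elim: k => [|k IH].
  rewrite (_ : centered_sum 0 = cst 0); first exact: measurable_cst.
  by apply/funext => w; rewrite /centered_sum big_nil.
rewrite (_ : centered_sum k.+1 = fun w => (centered_sum k w : 'rV[R]_n)
    + ((p k.+1 w : 'rV[R]_n) - m)); last first.
  by apply/funext => w; rewrite centered_sumS.
by apply: measurable_addv => //; apply: measurable_addv => //.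
Qed.

HB.instance Definition _ k :=
  isMeasurableFun.Build _ _ _ _ (centered_sum k) (measurable_centered_sum k).

Let measurable_step : measurable_fun setT (fun z : borel_rV R n * borel_rV R n =>
    (z.1 : 'rV[R]_n) + ((z.2 : 'rV[R]_n) - m) : borel_rV R n).
Proof.
apply: measurable_addv => //; apply: measurable_addv => //; exact: measurable_cst.
Qed.

Let event (s : seq nat) (B : nat -> set (borel_rV R n)) : set Omega :=
  \bigcap_(t in [set` s]) (p t @^-1` B t).

Let event_cons t s B (A : set (borel_rV R n)) : t \notin s ->
  event (t :: s) (fun u => if u == t then A else B u) = p t @^-1` A `&` event s B.
Proof.
move=> ts; apply/seteqP; split=> w.
  move=> h; split.
    by have := h t; rewrite /= inE eqxx; exact.
  move=> u us; have := h u; rewrite /= inE (us : u \in s) orbT.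
  by case: eqP us ts => [-> /= -> //|_ _ _]; exact.
move=> [h1 h2] u /=; rewrite inE; case: eqP => [-> _ //|_ /= us].
exact: h2.
Qed.

Let measurable_event s B : (forall t, measurable (B t)) -> measurable (event s B).
Proof.
move=> mB; apply: fin_bigcap_measurable => // t _.
exact: measurable_funPTI.
Qed.

(** Independence from all finite families of later events, rather than from the next sample alone,
    is what survives induction: the next sum is a function of the current sum and one sample, and
    the remaining events form the [N] of [independent_joint_law]. *)
Lemma centered_sum_independent k : (k <= T)%N ->
  forall (A : set (borel_rV R n)) s B, measurable A -> uniq s ->
  (forall t, t \in s -> (k < t <= T)%N) -> (forall t, measurable (B t)) ->
  P (centered_sum k @^-1` A `&` event s B)
    = (P (centered_sum k @^-1` A) * P (event s B))%E.
Proof.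
elim: k => [_|k IH kT] A s B mA us sT mB.
  have [A0|A0] := pselect (A 0).
    rewrite (_ : centered_sum 0 @^-1` A = setT) ?setTI ?probability_setT ?mul1e //.
    by apply/seteqP; split=> // w _; rewrite /= /centered_sum big_nil.
  rewrite (_ : centered_sum 0 @^-1` A = set0) ?set0I ?measure0 ?mul0e //.
  by rewrite -subset0 => w; rewrite /= /centered_sum big_nil.
pose step (z : borel_rV R n * borel_rV R n) : borel_rV R n :=
  (z.1 : 'rV[R]_n) + ((z.2 : 'rV[R]_n) - m).
have joint u C : uniq u -> (forall t, t \in u -> (k.+1 < t <= T)%N) ->
    (forall t, measurable (C t)) ->
    P (centered_sum k.+1 @^-1` A `&` event u C) =
    ((distribution P (centered_sum k) \x distribution P (p k.+1))%E
      (step @^-1` A) * P (event u C))%E.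
  move=> uu uT mC.
  have ku : k.+1 \notin u by apply/negP => /uT; rewrite ltnn.
  have mW : measurable (step @^-1` A).
    by rewrite -[X in measurable X]setTI; exact: measurable_step.
  have ind A' B' : measurable A' -> measurable B' ->
      P (centered_sum k @^-1` A' `&` (p k.+1 @^-1` B' `&` event u C))
      = (P (centered_sum k @^-1` A') * (P (p k.+1 @^-1` B') * P (event u C)))%E.
    move=> mA' mB'; pose C' t := if t == k.+1 then B' else C t.
    have mC' t : measurable (C' t) by rewrite /C'; case: ifP.
    have uu' : uniq (k.+1 :: u) by rewrite /= ku.
    have uT' t : t \in k.+1 :: u -> (k < t <= T)%N.
      by rewrite inE => /predU1P[->|/uT /andP[/ltnW -> ->]//]; rewrite ltnS leqnn.
    rewrite -event_cons // IH ?(ltnW kT) //; congr (_ * _)%E.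
    have inT t : t \in k.+1 :: u -> (1 <= t <= T)%N.
      by move/uT' => /andP[kt ->]; rewrite (leq_ltn_trans _ kt).
    rewrite (p_iid.2 _ _ uu' inT mC') big_cons /C' eqxx; congr (_ * _)%E.
    rewrite /event p_iid.2 //; last by move=> t tu; apply: inT; rewrite inE tu orbT.
    rewrite big_seq [RHS]big_seq; apply: eq_bigr => t tu.
    by case: eqP tu ku => [-> ->|].
  rewrite -(independent_joint_law (measurable_event u mC) ind mW).
  by congr (P (_ `&` _)); apply/seteqP; split=> w /=; rewrite centered_sumS.
rewrite joint //; congr (_ * _)%E.
(* With no later events, [joint] identifies the first factor as the law of the sum itself. *)
have := joint [::] B isT; rewrite (_ : event [::] B = setT).
  by rewrite setIT probability_setT mule1 => ->.
by apply/seteqP; split=> // w _ t.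
Qed.

Variable b : R.
Hypothesis b_gt0 : 0 < b.
Hypothesis D_bounded : \forall v \ae D, enorm ((v : 'rV[R]_n) - m) <= b.

Lemma centered_sum_joint_integral k (h : borel_rV R n * borel_rV R n -> \bar R) :
  (k < T)%N -> measurable_fun setT h -> (forall z, 0 <= h z)%E ->
  (\int[P]_w h (centered_sum k w, p k.+1 w)
    = \int[distribution P (centered_sum k) \x D]_z h z)%E.
Proof.
move=> kT mh h0.
have mSX : measurable_fun setT (fun w => (centered_sum k w, p k.+1 w)).
  by apply: measurable_fun_pair => //; exact: measurable_centered_sum.
transitivity (\int[pushforward P (fun w => (centered_sum k w, p k.+1 w))]_z h z)%E.
  by rewrite ge0_integral_pushforward.
pose m0 : {measure set (borel_rV R n * borel_rV R n) -> \bar R} :=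
  pushforward P (fun w => (centered_sum k w, p k.+1 w)).
apply: eq_measure_integral => W mW _.
symmetry; apply: (@product_measure_unique _ _ _ _ _ _ _ (m0 mSX)) => // A B mA mB.
have ktT : (1 <= k.+1 <= T)%N by [].
transitivity (distribution P (centered_sum k) A * distribution P (p k.+1) B)%E; last first.
  by congr (_ * _)%E; exact: p_iid.1.
rewrite /m0 /distribution /= /pushforward.
have := centered_sum_independent (ltnW kT) (s := [:: k.+1]) (B := fun=> B) mA isT.
have -> : event [:: k.+1] (fun=> B) = p k.+1 @^-1` B.
  apply/seteqP; split=> w /=; first by apply; rewrite /= inE.
  by move=> Bw u /=; rewrite inE => /eqP ->.
by apply => // t; rewrite inE => /eqP ->; rewrite ltnS leqnn.
Qed.

Let mgf k (theta : R) := (\int[P]_w (expR (theta * enorm (centered_sum k w : 'rV[R]_n) ^+ 2))%:E)%E.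

Let measurable_mgf d' (T' : measurableType d') (h : T' -> borel_rV R n) (theta : R) :
  measurable_fun setT h ->
  measurable_fun setT (fun w => (expR (theta * enorm (h w : 'rV[R]_n) ^+ 2))%:E).
Proof.
move=> mh; apply/measurable_EFinP; apply: measurable_expR_comp.
apply: measurable_funM => //; apply: measurable_funX; exact: measurable_enorm.
Qed.

Let mgfS k theta : (k < T)%N -> 0 <= theta ->
  (mgf k.+1 theta <= (expR (theta * b ^+ 2))%:E * mgf k (theta * (1 + 8 * theta * b ^+ 2)))%E.
Proof.
move=> kT theta0.
have joint := centered_sum_joint_integral kT (measurable_mgf theta measurable_step)
  (fun z => expR_ge0 _).
apply: (@le_trans _ _ (\int[distribution P (centered_sum k) \x D]_z (expR (theta
    * enorm ((z.1 : 'rV[R]_n) + ((z.2 : 'rV[R]_n) - m)) ^+ 2))%:E)%E).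
  rewrite le_eqVlt; apply/orP; left; apply/eqP; apply: etrans joint.
  by apply: eq_integral => w _; rewrite centered_sumS.
apply: (le_trans (mgf_sqr_enorm_step D_bounded (distribution P (centered_sum k)) theta0)).
rewrite ge0_integral_distribution //.
by apply: measurable_mgf; exact: measurable_id.
Qed.

(* The exponents theta k = 1 / (8 b^2 (K + k)) absorb the growth factor of each
   step and are halved after K steps. *)
Let mgf_bound K k : (0 < K)%N -> (k <= K)%N -> (k <= T)%N ->
  (mgf k (8 * b ^+ 2 * (K + k)%:R)^-1 <= (expR (k%:R / (8 * K%:R)))%:E)%E.
Proof.
move=> K0; have K0R : 0 < K%:R :> R by rewrite ltr0n.
have b2 : 0 < b ^+ 2 by rewrite exprn_gt0.
have mgf_le j x y : x <= y -> (mgf j x <= mgf j y)%E.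
  move=> xy; apply: ge0_le_integral => //.
  - by apply: measurable_mgf; exact: measurable_centered_sum.
  - by apply: measurable_mgf; exact: measurable_centered_sum.
  - by move=> w _; rewrite lee_fin ler_expR ler_wpM2r ?sqr_ge0.
elim: k => [_ _|k IH kK kT].
  rewrite mul0r expR0 /mgf.
  under eq_integral do rewrite /centered_sum big_nil enorm0 expr0n mulr0 expR0.
  by rewrite integral_cst // mul1e probability_le1.
set theta := (8 * b ^+ 2 * (K + k.+1)%:R)^-1.
have N0 : 0 < (K + k)%:R :> R by rewrite ltr0n addn_gt0 K0.
have N1 : (K + k.+1)%:R = (K + k)%:R + 1 :> R by rewrite addnS natr1.
have theta0 : 0 < theta by rewrite invr_gt0 !mulr_gt0 // N1 ltr_wpDl // ltW.
apply: (le_trans (mgfS kT (ltW theta0))).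
apply: (@le_trans _ _ ((expR (1 / (8 * K%:R)))%:E * (expR (k%:R / (8 * K%:R)))%:E)%E).
  apply: lee_pmul; rewrite ?lee_fin ?expR_ge0 //.
  - by apply: integral_ge0 => w _; rewrite lee_fin expR_ge0.
  - have -> : theta * b ^+ 2 = (8 * (K + k.+1)%:R)^-1.
      by rewrite /theta [8 * _]mulrC -mulrA invfM mulrC mulrA mulfV ?mul1r ?gt_eqF.
    rewrite ler_expR div1r lef_pV2 ?posrE ?mulr_gt0 ?ltr0n ?addn_gt0 ?K0 //.
    by rewrite ler_pM2l // ler_nat leq_addr.
  apply: le_trans (IH (ltnW kK) (ltnW kT)); apply: mgf_le.
  rewrite /theta N1; move: (K + k)%:R N0 => N N0.
  have N2 : 0 < N + 1 by rewrite ltr_wpDl // ltW.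
  (* In units of [1 / (8 b^2)], the old exponent [1/N] exceeds the grown one,
     [(1 + 1/(N+1)) / (N+1)], by exactly [1 / (N (N+1)^2)]. *)
  rewrite -subr_ge0 (_ : _ - _ = (8 * b ^+ 2 * N * (N + 1) ^+ 2)^-1).
    by rewrite invr_ge0 !mulr_ge0 ?sqr_ge0 ?ltW.
  by field; rewrite !gt_eqF.
by rewrite -EFinM -expRD lee_fin ler_expR -mulrDl nat1r.
Qed.

Lemma centered_sum_tail k (r : R) : (0 < k <= T)%N -> 0 <= r ->
  (P [set w | (r <= enorm (centered_sum k w : 'rV[R]_n))%R]
    <= (2 * expR (- (r ^+ 2 / (16 * b ^+ 2 * k%:R))))%:E)%E.
Proof.
move=> /andP[k0 kT] r0.
have k0R : 0 < k%:R :> R by rewrite ltr0n.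
have b2 : 0 < b ^+ 2 by rewrite exprn_gt0.
set A := mkset _.
have mA : measurable A by apply: measurable_enorm_ge; exact: measurable_centered_sum.
(* This is the last exponent of [mgf_bound] with [K = k]; there the moment is at most
   [expR (1 / 8)], hence below 2, and Markov's inequality gives the tail. *)
set theta := (16 * b ^+ 2 * k%:R)^-1.
have theta0 : 0 < theta by rewrite invr_gt0 !mulr_gt0.
have : ((expR (theta * r ^+ 2))%:E * P A <= mgf k theta)%E.
  rewrite -integral_cst // /mgf.
  apply: (@le_trans _ _
    (\int[P]_(w in A) (expR (theta * enorm (centered_sum k w : 'rV[R]_n) ^+ 2))%:E)%E).
    apply: ge0_le_integral => //.
    - by move=> w _ /=; rewrite lee_fin expR_ge0.
    - by apply: measurable_funTS; apply: measurable_mgf; exact: measurable_centered_sum.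
    move=> w Aw; rewrite lee_fin ler_expR ler_pM2l // ler_pXn2r ?nnegrE //.
    exact: enorm_ge0.
  apply: ge0_subset_integral => //.
  - by apply: measurable_mgf; exact: measurable_centered_sum.
have thetaE : theta = (8 * b ^+ 2 * (k + k)%:R)^-1.
  by rewrite /theta natrD; congr (_^-1); ring.
have := mgf_bound k0 (leqnn k) kT; rewrite -thetaE => h1 h2.
have e2 : expR (k%:R / (8 * k%:R)) <= 2 :> R.
  rewrite (_ : _ / _ = 1 / 8); last by field; rewrite gt_eqF.
  have := expR_ge1Dx (- (1 / 8) : R); have := expRxMexpNx_1 (1 / 8 : R).
  have := expR_gt0 (1 / 8 : R); nra.
have PAE : P A = (fine (P A))%:E by rewrite fineK // fin_num_measure.
have := le_trans (le_trans h2 h1) (_ : _ <= 2%:E)%E; rewrite lee_fin => /(_ e2).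
rewrite PAE -EFinM !lee_fin => h.
rewrite -(ler_pM2l (expR_gt0 (theta * r ^+ 2))) [leRHS]mulrCA.
rewrite (_ : r ^+ 2 / _ = theta * r ^+ 2); last by rewrite mulrC.
by rewrite expRxMexpNx_1 mulr1.
Qed.

End random_walk.

(** * Rate summation, bounded means and ranges *)

Lemma sum_inv_sqrt (R : realType) (T : nat) :
  \sum_(2 <= t < T.+1) (Num.sqrt (t.-1%:R : R))^-1 <= 2 * Num.sqrt T.-1%:R.
Proof.
case: T => [|T] /=; first by rewrite big_geq // mulr_ge0 ?sqrtr_ge0.
elim: T => [|T IH]; first by rewrite big_geq // mulr_ge0 ?sqrtr_ge0.
rewrite big_nat_recr //= (le_trans (lerD IH (lexx _))) //.
set a := Num.sqrt T%:R; set b := Num.sqrt T.+1%:R.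
have b0 : 0 < b by rewrite sqrtr_gt0 ltr0n.
have b2 : b ^+ 2 = a ^+ 2 + 1 by rewrite !sqr_sqrtr // natr1.
rewrite -(ler_pM2r b0) mulrDl mulVf ?gt_eqF //.
(* As [b ^+ 2 = a ^+ 2 + 1], the claim [2 * a * b + 1 <= 2 * b ^+ 2] is
   [2 * a * b <= a ^+ 2 + b ^+ 2]. *)
have := sqr_ge0 (a - b); rewrite sqrrB; nra.
Qed.

Section bounded_mean.
Variables (R : realType) (n : nat) (D : probability (borel_rV R n) R) (b : R).
Let m : 'rV[R]_n := mean_vector D.
Hypothesis b0 : 0 <= b.
Hypothesis D_bounded : \forall v \ae D, enorm (v : 'rV[R]_n) <= b.

(** If [|m| > b], then [<m, v - m>] is almost surely at most [- |m| (|m| - b)], a negative constant,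
    yet it integrates to 0. *)
Lemma enorm_mean_vector : enorm m <= b.
Proof.
have Dm : \forall v \ae D, enorm ((v : 'rV[R]_n) - m) <= b + enorm m.
  apply: ae_imply D_bounded => v h.
  by rewrite (le_trans (ler_enormD _ _)) // enormN lerD2r.
rewrite leNgt; apply/negP => bm.
have m0 : 0 < enorm m by exact: le_lt_trans bm.
set c := enorm m * (enorm m - b).
have c0 : 0 < c by rewrite mulr_gt0 // subr_gt0.
pose h (v : borel_rV R n) := dotv m ((v : 'rV[R]_n) - m).
have mh : measurable_fun setT h.
  apply: measurable_dotv => //.
  by apply: measurable_addv => //; exact: measurable_cst.
have hI : D.-integrable setT (EFin \o h).
  apply: (@ae_bounded_integrable _ _ _ _ (enorm m * (b + enorm m))) => //.
  apply: ae_imply Dm => v vb.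
  have vm : enorm m * enorm ((v : 'rV[R]_n) - m) <= enorm m * (b + enorm m).
    by rewrite ler_wpM2l ?enorm_ge0.
  rewrite ler_norml (le_trans (dotv_le_enorm _ _) vm) andbT lerNl -dotvNr.
  by rewrite (le_trans (dotv_le_enorm _ _)) // enormN.
have mg : measurable_fun setT (fun v => h v + c) by exact: measurable_funD.
have : (\int[D]_v (h v + c)%:E = c%:E)%E.
  under eq_integral do rewrite EFinD.
  rewrite integralD //; last exact: finite_measure_integrable_cst.
  rewrite (integral_centered_dotv Dm) add0e integral_cst // -[RHS]mule1.
  by congr (_ * _)%E; exact: probability_setT.
(* Almost surely [h v + c <= 0]; rewriting it as minus an absolute value makes the sign hold
   everywhere. *)
rewrite (_ : (\int[D]_v _ = \int[D]_v (- `|h v + c|%:E))%E); last first.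
  apply: ae_eq_integral => //.
  - exact/measurable_EFinP.
  - apply: measurableT_comp => //; apply/measurable_EFinP; exact: measurableT_comp.
  apply: ae_imply D_bounded => v vb _; rewrite -EFinN; congr (_%:E).
  suff : h v + c <= 0 by move=> hc; rewrite ler0_norm ?opprK.
  rewrite /h dotvBr -sqr_enorm /c.
  have := dotv_le_enorm m v.
  have : enorm m * enorm (v : 'rV[R]_n) <= enorm m * b by rewrite ler_pM2l.
  lra.
move=> E; have : (0 < c%:E)%E by rewrite lte_fin.
rewrite -E ltNge => /negP; apply.
rewrite integral_ge0N // leeNl oppe0; apply: integral_ge0 => v _.
by rewrite lee_fin.
Qed.

Lemma centered_bounded : \forall v \ae D, enorm ((v : 'rV[R]_n) - m) <= 2 * b.
Proof.
apply: ae_imply D_bounded => v h.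
rewrite (le_trans (ler_enormD _ _)) // enormN mulr_natl mulr2n lerD //.
exact: enorm_mean_vector.
Qed.
End bounded_mean.

Lemma enorm_empirical_mean_sub (R : realType) (n : nat) (p : nat -> 'rV[R]_n)
    (m : 'rV[R]_n) (t : nat) (e : R) : (1 < t)%N ->
  enorm (\sum_(1 <= s < t) (p s - m)) <= e * Num.sqrt t.-1%:R ->
  enorm (m - empirical_mean p t) <= e / Num.sqrt t.-1%:R.
Proof.
move=> t1 h; have t0 : 0 < t.-1%:R :> R by rewrite ltr0n; case: t t1 {h} => [|[]].
have -> : m - empirical_mean p t = - (t.-1%:R^-1 *: \sum_(1 <= s < t) (p s - m)).
  rewrite sumrB scalerBr opprB; congr (_ - _).
  by rewrite sumr_const_nat subn1 -[m *+ _]scaler_nat scalerA mulVf ?scale1r ?gt_eqF.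
rewrite enormN enormZ ger0_norm ?invr_ge0 ?(ltW t0) // mulrC ler_pdivrMr //.
apply: (le_trans h); set r := Num.sqrt _.
have r0 : 0 < r by rewrite sqrtr_gt0.
have -> : t.-1%:R = r ^+ 2 :> R by rewrite sqr_sqrtr // ltW.
by rewrite expr2 mulrA divfK ?gt_eqF.
Qed.

(** The Lipschitz property bounds the set under [sup], so that the supremum is a genuine upper
    bound. *)
Lemma utility_range_ge (R : realType) (n : nat) (X : set 'rV[R]_n) (T : nat)
    (b L : R) f g t x y :
  decision_set X -> (forall t, (1 <= t <= T)%N -> utility X b L (f t) (g t)) ->
  (1 <= t <= T)%N -> X x -> X y -> `|f t x - f t y| <= utility_range X T f.
Proof.
move=> HX Hf tT Xx Xy; apply: ub_le_sup; last by exists t, x, y.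
exists (`|b| * diameter X) => _ [s [y' [z [sT Xy' Xz ->]]]].
apply: (le_trans (utility_Lipschitz (Hf _ sT) Xz Xy')).
apply: (@le_trans _ _ (`|b| * enorm (y' - z))).
  by rewrite ler_wpM2r ?enorm_ge0 ?ler_norm.
by rewrite ler_wpM2l // diameter_ge //; exact: decision_set_bounded HX.
Qed.

(** Both [<u, y>] and [B / T] lie between 0 and [b * diameter X], hence so does the distance between
    them. *)
Lemma constraint_range_le (R : realType) (n : nat) (X : set 'rV[R]_n) (T : nat)
    (B b : R) (D : probability (borel_rV R n) R) :
  decision_set X ->
  prob_support D `<=` [set u | lev 0 u /\ enorm u <= b] ->
  0 <= b -> 0 <= B / T%:R <= b * diameter X ->
  constraint_range X T B D <= b * diameter X.
Proof.
move=> HX supp b0 /andP[B0 Bb].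
have [S0|S0] := eqVneq [set `|dotv z.1 z.2 - B / T%:R| | z in prob_support D `*` X] set0.
  by rewrite /constraint_range S0 sup0 (le_trans B0 Bb).
apply: ge_sup; first exact/set0P.
move=> _ [[u y] [/= /supp[u0 ub] Xy] <-].
have d0 := dotv_ge0 u0 (decision_set_ge0 HX Xy).
have d1 : dotv u y <= b * diameter X.
  apply: (le_trans (dotv_le_enorm _ _)); apply: ler_pM; rewrite ?enorm_ge0 //.
  by rewrite -[y]subr0; apply: diameter_ge Xy (decision_set_0 HX); exact: decision_set_bounded HX.
rewrite ler_norml; lra.
Qed.

Lemma constraint_range_ge0 (R : realType) (n : nat) (X : set 'rV[R]_n) (T : nat)
    (B : R) (D : probability (borel_rV R n) R) : 0 <= constraint_range X T B D.
Proof.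
rewrite /constraint_range; set S := [set _ | _ in _].
have [[[y Sy] ubS]|/sup_out -> //] := pselect (has_sup S).
by apply: le_trans (ub_le_sup ubS Sy); case: Sy => z _ <-.
Qed.

Lemma violation_bound_ge0 (R : realType) (C : R) (n : nat)
    (diam beta L F G sigma : R) (T : nat) (B eps : R) :
  0 <= C -> 0 <= diam -> 0 <= beta -> 0 <= L -> 0 <= F -> 0 <= sigma -> 0 < B ->
  0 <= violation_bound C n diam beta L F G sigma T B eps.
Proof.
move=> C0 d0 b0 L0 F0 s0 B0.
by rewrite /violation_bound !addr_ge0 // ?mulr_ge0 ?sqrtr_ge0 ?invr_ge0 ?addr_ge0
  ?mulr_ge0 ?invr_ge0 ?sqr_ge0 ?(ltW B0).
Qed.

(** * The violation bound *)

Lemma OLFW_violation_bound (R : realType) (n T K : nat) (X : set 'rV[R]_n)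
    (B mu beta L eps G F : R) (gamma : nat -> R) (v1 : nat -> 'rV[R]_n)
    f gradf (p : nat -> 'rV[R]_n) m x v lambda :
  let diam := diameter X in let l := ln (2 * T%:R / eps) in
  (0 < n)%N -> (0 < T)%N -> K%:R = Num.sqrt T%:R :> R -> 0 < B -> 0 < eps < 1 ->
  decision_set X -> 0 < diam -> 0 < beta -> 0 <= L -> 0 <= G ->
  (B / T%:R <= beta * diam -> G <= beta * diam) ->
  mu = diam / (beta * Num.sqrt T%:R) ->
  (forall t, (1 <= t <= T)%N -> utility X beta L (f t) (gradf t)) ->
  (forall t y, (1 <= t <= T)%N -> X y -> f t y <= F) ->
  (forall t, (2 <= t <= T)%N -> gamma t = Num.sqrt (2 * G ^+ 2 * l / t%:R)) ->
  (forall k, (1 <= k <= K)%N -> X (v1 k)) ->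
  OLFW_run X T K B mu (beta ^+ 2) gamma v1 gradf p x v lambda ->
  (forall t, (1 <= t <= T)%N -> enorm (p t) <= beta) -> enorm m <= beta ->
  (forall t, (2 <= t <= T)%N ->
    enorm (\sum_(1 <= s < t) (p s - m)) <= 8 * beta * Num.sqrt l * Num.sqrt t.-1%:R) ->
  constraint_violation T B m (fun t => x t K.+1)
    <= violation_bound 10 n diam beta L F G (2 * beta) T B eps.
Proof.
move=> diam l n0 T0 KE B0 /andP[e0 e1] HX d0 b0 L0 G0 GB muE Hf FF gE v1X run pb mb pm.
have T0R : 0 < T%:R :> R by rewrite ltr0n.
have T1R : 1 <= T%:R :> R by rewrite ler1n.
have sT0 : 0 < Num.sqrt T%:R :> R by rewrite sqrtr_gt0.
have K0 : (0 < K)%N by rewrite -(ltr0n R) KE.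
have mu0 : 0 < mu by rewrite muE divr_gt0 // mulr_gt0.
have F0 : 0 <= F.
  have X0 := decision_set_0 HX.
  by apply: le_trans (FF 1%N 0 _ X0); rewrite ?(utility_normalized (Hf 1%N _)) ?T0.
have q1 : 1 <= 2 * T%:R / eps.
  by rewrite ler_pdivlMr // mul1r; lra.
have q0 : 0 < 2 * T%:R / eps by rewrite (lt_le_trans ltr01).
have l0 : 0 <= l by rewrite ln_ge0.
have gamma0 t : (2 <= t <= T)%N -> 0 <= gamma t by move=> tT; rewrite gE // sqrtr_ge0.
have xX t : (1 <= t <= T)%N -> X (x t K.+1).
  by move=> tT; apply: (run_iterate_in HX v1X run) => //=.
have mx t : (1 <= t <= T)%N -> dotv m (x t K.+1) <= diam * beta.
  move=> tT; apply: (le_trans (dotv_le_enorm _ _)); rewrite mulrC.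
  apply: ler_pM; rewrite ?enorm_ge0 // -[x t _]subr0.
  exact: diameter_ge (decision_set_bounded HX) (xX t tT) (decision_set_0 HX).
rewrite /constraint_violation.
(* If B / T exceeds beta * diam, no action violates the constraint on average.
   Otherwise G <= beta * diam, and the sum of the gamma_t, which is twice the
   first term of the bound, is absorbed by the constant of the second one. *)
have [Bb|Bb] := leP (B / T%:R) (beta * diam); last first.
  apply: (@le_trans _ _ 0); last first.
    by apply: violation_bound_ge0 => //; rewrite ?mulr_ge0 ?(ltW d0) ?(ltW b0).
  rewrite subr_le0; apply: (@le_trans _ _ (\sum_(1 <= t < T.+1) (diam * beta))).
    by apply: ler_sum_nat => t tT; exact: mx.
  rewrite sumr_const_nat subn1 /= -mulr_natr -ler_pdivlMr // ltW //.
  by rewrite mulrC.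
have {}GB := GB Bb.
have surr := run_surrogate_sum HX T0 K0 B0 mu0 b0 L0 Hf gamma0 v1X run pb d0 muE KE
  (fun t tT => FF t _ tT (xX t tT)).
set W := diam * beta * Num.sqrt l.
have W0 : 0 <= W by rewrite !mulr_ge0 ?sqrtr_ge0 ?ltW.
(* The 10 is 2 for removing [gamma t] from the surrogate and 8 for the estimation error of the
   mean. *)
have step t : (2 <= t < T.+1)%N -> dotv m (x t K.+1) - B / T%:R
    <= surrogate_constraint T B gamma p t (x t K.+1) + 10 * W * (Num.sqrt t.-1%:R)^-1.
  move=> tT; have [t2 _] := andP tT.
  have tT1 : (1 <= t <= T)%N by case/andP: tT => /ltnW -> /=.
  have r0 : 0 < t.-1%:R :> R by rewrite ltr0n; case: t t2 {tT tT1} => [|[]].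
  have sr0 : 0 < Num.sqrt t.-1%:R :> R by rewrite sqrtr_gt0.
  have h1 : gamma t <= 2 * W * (Num.sqrt t.-1%:R)^-1.
    have -> : 2 * W * (Num.sqrt t.-1%:R)^-1 = Num.sqrt ((2 * W * (Num.sqrt t.-1%:R)^-1) ^+ 2).
      by rewrite sqrtr_sqr ger0_norm // divr_ge0 ?sqrtr_ge0 // mulr_ge0.
    rewrite gE // ler_wsqrtr // !exprMn exprVn !sqr_sqrtr ?(ltW r0) //.
    apply: ler_pM; rewrite ?invr_ge0 ?mulr_ge0 ?sqr_ge0 //.
      have : G ^+ 2 * l <= diam ^+ 2 * beta ^+ 2 * l.
        rewrite ler_wpM2r // -exprMn ler_pXn2r ?nnegrE ?mulr_ge0 ?(ltW d0) ?(ltW b0) //.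
        by rewrite mulrC.
      have : 0 <= G ^+ 2 * l by rewrite mulr_ge0 ?sqr_ge0.
      rewrite !mulrA; lra.
    by rewrite lef_pV2 ?posrE ?ler_nat ?leq_pred // ltr0n (leq_trans _ t2).
  have h2 : dotv (m - empirical_mean p t) (x t K.+1) <= 8 * W * (Num.sqrt t.-1%:R)^-1.
    apply: (le_trans (dotv_le_enorm _ _)).
    have -> : 8 * W * (Num.sqrt t.-1%:R)^-1
        = 8 * beta * Num.sqrt l / Num.sqrt t.-1%:R * diam by rewrite /W; ring.
    apply: ler_pM; rewrite ?enorm_ge0 //.
      by apply: enorm_empirical_mean_sub t2 _; exact: pm.
    rewrite -[x t _]subr0.
    exact: diameter_ge (decision_set_bounded HX) (xX t tT1) (decision_set_0 HX).
  move: h1 h2; rewrite /surrogate_constraint dotvBl; lra.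
have -> : \sum_(1 <= t < T.+1) dotv m (x t K.+1) - B
    = \sum_(1 <= t < T.+1) (dotv m (x t K.+1) - B / T%:R).
  by rewrite sumrB sumr_const_nat subn1 /= -[_ *+ T]mulr_natr divfK // gt_eqF.
(* Round 1 has no sample to rely on; it costs at most [diam * beta], the last term of the bound. *)
rewrite big_ltn //.
have := mx 1%N (introT andP (conj isT T0)).
have := ler_sum_nat step; rewrite [leRHS]big_split /= -mulr_sumr.
have := ler_wpM2l (mulr_ge0 (ler0n _ 10) W0) (sum_inv_sqrt R T).
have sTT : Num.sqrt T.-1%:R <= Num.sqrt T%:R :> R by rewrite ler_wsqrtr // ler_nat leq_pred.
have h3 : 10 * W * (2 * Num.sqrt T.-1%:R)
    <= 10 * diam * (2 * beta) * Num.sqrt (T%:R * ln (2 * n%:R * T%:R / eps)).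
  have -> : 10 * W * (2 * Num.sqrt T.-1%:R)
    = 10 * diam * (2 * beta) * (Num.sqrt T.-1%:R * Num.sqrt l) by rewrite /W; ring.
  rewrite ler_wpM2l ?mulr_ge0 ?(ltW d0) ?(ltW b0) // sqrtrM //.
  apply: ler_pM; rewrite ?sqrtr_ge0 // ler_wsqrtr //.
  rewrite /l ler_ln ?posrE // ?divr_gt0 ?mulr_gt0 ?ltr0n //.
  rewrite ler_pM2r ?invr_gt0 // ler_pM2r // ler_peMr // ler1n //.
have BT : 0 < B / T%:R by rewrite divr_gt0.
have s0 := sqrtr_ge0 (2 * G ^+ 2 * T%:R * l).
move: surr; rewrite /violation_bound -/l -/diam; lra.
Qed.

Lemma violation_bound_Otilde (R : realType) (C : R) (n : nat)
    (diam beta L F G sigma rho : R) :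
  exists (A : R) (k : nat), forall (T : nat) (B eps : R),
    (0 < T)%N -> 0 < B -> T%:R / B = rho -> 0 < eps < 1 ->
    violation_bound C n diam beta L F G sigma T B eps
      <= A * Num.sqrt T%:R * ln (2 * T%:R / eps) ^+ k.
Proof.
(* The logarithm in the bound is at least [ln 2], so [q * l >= 1] turns terms without logarithm into
   multiples of [l]. *)
pose q : R := (ln 2)^-1.
pose a1 := Num.sqrt (2 * G ^+ 2) * (q + 1).
pose a2 := `|C * diam * sigma| * ((1 + `|ln (n%:R : R)|) * q + 1).
pose a3 := `|rho * diam * beta * F|.
pose a4 := `|rho * diam * beta * (L * diam ^+ 2 / 2 + 2 * diam * beta)|.
pose a5 := `|diam * beta|.
exists (a1 + a2 + a3 * q + a4 * q + a5 * q), 1%N => T B eps T0 B0 rhoE /andP[e0 e1].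
rewrite expr1; set l := ln _; set s := Num.sqrt T%:R.
have T1 : 1 <= T%:R :> R by rewrite ler1n.
have s1 : 1 <= s by rewrite -[1]sqrtr1 ler_wsqrtr.
have q2 : 2 <= 2 * T%:R / eps by rewrite ler_pdivlMr // ler_pM //; lra.
have ln2 : 0 < ln 2 :> R by rewrite ln_gt0 // ltr1n.
have l2 : ln 2 <= l by rewrite ler_ln ?posrE // (lt_le_trans _ q2).
have l0 : 0 < l := lt_le_trans ln2 l2.
have ql : 1 <= q * l by rewrite /q mulrC ler_pdivlMr // mul1r.
have q0 : 0 < q by rewrite invr_gt0.
(* A crude bound, enough because one full power of the logarithm is allowed. *)
have sq (u : R) : 0 <= u -> Num.sqrt u <= 1 + u.
  move=> u0; rewrite -[leRHS]ger0_norm ?addr_ge0 // -sqrtr_sqr ler_wsqrtr //.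
  by have := sqr_ge0 u; rewrite sqrrD; lra.
have sl : s <= s * (q * l) by rewrite ler_peMr // (le_trans ler01).
have b1 : Num.sqrt (2 * G ^+ 2 * T%:R * l) <= a1 * s * l.
  have G2 : 0 <= 2 * G ^+ 2 by rewrite mulr_ge0 ?sqr_ge0.
  have G2T : 0 <= 2 * G ^+ 2 * T%:R by rewrite mulr_ge0.
  rewrite (sqrtrM _ G2T) (sqrtrM _ G2) -/s.
  rewrite /a1 -!mulrA ler_wpM2l ?sqrtr_ge0 // mulrCA ler_wpM2l ?sqrtr_ge0 //.
  by apply: (le_trans (sq _ (ltW l0))); rewrite mulrDl mul1r lerD2r.
have lnn : ln (2 * n%:R * T%:R / eps) <= `|ln (n%:R : R)| + l.
  (* For [n = 0] the left side is the logarithm of 0, which is 0 by convention. *)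
  have [->|n0] := posnP n.
    by rewrite mulr0 !mul0r (ln0 (lexx _)) addr_ge0 // ltW.
  rewrite (_ : _ / eps = n%:R * (2 * T%:R / eps)); last by ring.
  rewrite lnM ?posrE ?ltr0n ?(lt_le_trans _ q2) // lerD2r; exact: ler_norm.
have b2 : C * diam * sigma * Num.sqrt (T%:R * ln (2 * n%:R * T%:R / eps)) <= a2 * s * l.
  apply: (@le_trans _ _ (`|C * diam * sigma| * Num.sqrt (T%:R * (`|ln (n%:R : R)| + l)))).
    apply: (le_trans (ler_norm _)); rewrite normrM ler_wpM2l //.
    by rewrite ger0_norm ?sqrtr_ge0 // ler_wsqrtr // ler_wpM2l.
  rewrite /a2 -!mulrA ler_wpM2l // sqrtrM // -/s mulrCA ler_wpM2l ?sqrtr_ge0 //.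
  apply: (le_trans (sq _ _)); first by rewrite addr_ge0 // ltW.
  rewrite mulrDl mul1r addrA lerD2r -mulrA ler_peMr //.
have b3 : T%:R / B * diam * beta * F * s <= a3 * q * s * l.
  rewrite rhoE; apply: (@le_trans _ _ (a3 * s)).
    by rewrite ler_wpM2r ?ler_norm // (le_trans ler01).
  by rewrite -!mulrA ler_wpM2l ?normr_ge0 // mulrCA.
have bc (u : R) : u <= `|u| * q * s * l.
  apply: (le_trans (ler_norm _)); rewrite -!mulrA ler_peMr // mulrCA.
  by rewrite (le_trans s1).
have b4 : T%:R * diam * beta / B * (L * diam ^+ 2 / 2 + 2 * diam * beta) <= a4 * q * s * l.
  apply: le_trans (bc _); rewrite -rhoE.
  by rewrite (_ : T%:R * diam * beta / B = T%:R / B * diam * beta) //; ring.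
have b5 := bc (diam * beta).
rewrite /violation_bound -/l -/s; move: b1 b2 b3 b4 b5; rewrite -/a5 !mulrDl; lra.
Qed.

Lemma utility_weaken (R : realType) (n : nat) (X : set 'rV[R]_n) (b b' L : R) f g :
  b <= b' -> utility X b L f g -> utility X b' L f g.
Proof.
move=> bb [h1 h2 h3 h4 h5 h6 h7]; split=> // x y Xx Xy.
by apply: (le_trans (h6 x y Xx Xy)); rewrite ler_wpM2r ?enorm_ge0.
Qed.

Lemma iid_enorm_gt_eq0 d (Omega : measurableType d) (R : realType) (n T : nat)
    (P : probability Omega R) (D : probability (borel_rV R n) R)
    (p : nat -> {RV P >-> borel_rV R n}) t b : iid T D p -> (1 <= t <= T)%N ->
  (\forall v \ae D, enorm (v : 'rV[R]_n) <= b) ->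
  P [set w | b < enorm (p t w : 'rV[R]_n)] = 0%E.
Proof.
move=> p_iid tT Db.
pose A : set (borel_rV R n) := [set v | b < enorm (v : 'rV[R]_n)].
have mA : measurable A by exact: measurable_enorm_gt.
transitivity (D A); first exact: p_iid.1.
apply: measure_negligible => //; apply: negligibleS Db => v /=.
by rewrite /A /= ltNge => /negP.
Qed.

Theorem theorem2 (R : realType) :
  exists c C : R, [/\ 0 < c, 0 < C,
    (forall (n T K : nat) (X : set 'rV[R]_n) (B beta_f beta_p L eps : R)
        (f : nat -> 'rV[R]_n -> R) (gradf : nat -> 'rV[R]_n -> 'rV[R]_n)
        (D : probability (borel_rV R n) R)
        (d : measure_display) (Omega : measurableType d)
        (P : probability Omega R) (p : nat -> {RV P >-> borel_rV R n})
        (mu delta : R) (gamma : nat -> R) (v1 : nat -> 'rV[R]_n)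
        (x v : Omega -> nat -> nat -> 'rV[R]_n) (lambda : Omega -> nat -> R),
      let diam := diameter X in
      let beta := Num.max beta_f beta_p in
      let sigma := c * beta in
      let F := utility_range X T f in
      let G := constraint_range X T B D in
      let pbar := mean_vector D in
      (0 < n)%N -> (0 < T)%N -> K%:R = Num.sqrt (T%:R : R) ->
      0 < B -> 0 < eps < 1 ->
      decision_set X ->
      (forall t, (1 <= t <= T)%N -> utility X beta_f L (f t) (gradf t)) ->
      prob_support D `<=` [set u | lev 0 u /\ enorm u <= beta_p] ->
      iid T D p ->
      0 < mu -> mu = diam / (beta * Num.sqrt T%:R) ->
      0 < delta -> delta = beta ^+ 2 ->
      gamma 1%N = 0 ->
      (forall t, (2 <= t <= T)%N ->
        gamma t = Num.sqrt (2 * G ^+ 2 * ln (2 * T%:R / eps) / t%:R)) ->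
      (forall k, (1 <= k <= K)%N -> X (v1 k)) ->
      (forall w, OLFW_run X T K B mu delta gamma v1 gradf
                   (fun t => p t w) (x w) (v w) (lambda w)) ->
      (forall (t : nat) (zeta : R), (1 <= t <= T)%N -> 0 <= zeta ->
        (P [set w | (zeta <= enorm ((p t w : 'rV[R]_n) - pbar))%R]
          <= (2 * expR (- (zeta ^+ 2 / (2 * sigma ^+ 2))))%:E)%E) /\
      (exists E : set Omega,
        [/\ measurable E, ((1 - eps)%:E <= P E)%E &
          forall w, E w ->
            constraint_violation T B pbar (fun t => x w t K.+1)
              <= violation_bound C n diam beta L F G sigma T B eps])) &
    (forall (n : nat) (diam beta L F G sigma rho : R),
      exists (A : R) (k : nat), forall (T : nat) (B eps : R),
        (0 < T)%N -> 0 < B -> T%:R / B = rho -> 0 < eps < 1 ->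
        violation_bound C n diam beta L F G sigma T B eps
          <= A * Num.sqrt T%:R * ln (2 * T%:R / eps) ^+ k)].
Proof.
exists 2, 10; split => //; last first.
  exact: violation_bound_Otilde.
move=> n T K X B beta_f beta_p L eps f gradf D d Omega P p mu delta gamma v1 x v lambda.
move=> diam beta sigma F G pbar n0 T0 KE B0 /andP[e0 e1] HX Hf supp p_iid.
move=> mu0 muE _ deltaE _ gE v1X run.
have bX := decision_set_bounded HX; have X0 := decision_set_0 HX.
have T0R : 0 < T%:R :> R by rewrite ltr0n.
have sT0 : 0 < Num.sqrt T%:R :> R by rewrite sqrtr_gt0.
have d_ge0 : 0 <= diam by apply: le_trans (diameter_ge bX X0 X0); exact: enorm_ge0.
(* Positivity of [mu] forces both [diam] and [beta] to be positive. *)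
have d0 : 0 < diam.
  rewrite lt_neqAle d_ge0 andbT eq_sym; apply: contraTneq mu0 => dE.
  by rewrite muE -/diam dE mul0r ltxx.
have b0 : 0 < beta.
  by move: mu0; rewrite muE pmulr_rgt0 // invr_gt0 pmulr_lgt0.
have {}Hf t : (1 <= t <= T)%N -> utility X beta L (f t) (gradf t).
  by move=> tT; apply: utility_weaken (Hf t tT); rewrite le_max lexx.
have L0 : 0 <= L.
  by apply: utility_smooth_ge0 HX d0 (Hf 1%N _); rewrite T0.
have supp' : prob_support D `<=` [set u | lev 0 u /\ enorm u <= beta].
  by move=> u /supp[u0 ub]; split=> //; rewrite (le_trans ub) // le_max lexx orbT.
have Db : \forall u \ae D, enorm (u : 'rV[R]_n) <= beta.
  apply: negligibleS (negligible_not_support D) => u.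
  by apply: contra_not => /supp'[].
have mb : enorm pbar <= beta by exact: enorm_mean_vector (ltW b0) Db.
have Dc := centered_bounded (ltW b0) Db.
have s0 : 0 < sigma by rewrite mulr_gt0.
split.
  move=> t zeta tT z0.
  pose A : set (borel_rV R n) := [set u | zeta <= enorm ((u : 'rV[R]_n) - pbar)].
  have mA : measurable A.
    by apply: measurable_enorm_ge; apply: measurable_addv => //; exact: measurable_cst.
  rewrite (_ : P _ = D A); last exact: p_iid.1.
  (* Beyond [sigma = 2 * beta] the event is null; up to [sigma] the right side is at least
     [2 * (1 - 1 / 2) = 1]. *)
  have [zs|zs] := leP zeta sigma; last first.
    rewrite (_ : D A = 0%E) ?lee_fin ?mulr_ge0 ?expR_ge0 //.
    apply: measure_negligible => //; apply: negligibleS Dc => u /=.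
    by rewrite /A /= => zu; apply/negP; rewrite -ltNge (lt_le_trans zs).
  apply: (le_trans (probability_le1 D mA)); rewrite lee_fin.
  have h : zeta ^+ 2 / (2 * sigma ^+ 2) <= 1 / 2.
    rewrite ler_pdivrMr ?mulr_gt0 ?exprn_gt0 // mulrA divrK ?mul1r ?unitfE //.
    by rewrite ler_pXn2r ?nnegrE // ltW.
  have := expR_ge1Dx (- (zeta ^+ 2 / (2 * sigma ^+ 2))); lra.
set l := ln (2 * T%:R / eps).
have q1 : 1 <= 2 * T%:R / eps.
  have T1R : 1 <= T%:R :> R by rewrite ler1n.
  by rewrite ler_pdivlMr // mul1r; lra.
have q0 : 0 < 2 * T%:R / eps := lt_le_trans ltr01 q1.
have l0 : 0 <= l by rewrite ln_ge0.
(* Chosen so that the exponent in [centered_sum_tail] with step bound [2 * beta] is exactly [- l],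
   and [2 * expR (- l) = eps / T]. *)
pose r k : R := 8 * beta * Num.sqrt l * Num.sqrt k%:R.
pose bad1 k := [set w | beta < enorm (p k.+1 w : 'rV[R]_n)].
(* At [k = 0] both the sum and [r 0] vanish, so the non-strict inequality would make every outcome
   bad. *)
pose bad2 k := if k is 0%N then set0 else [set w | r k <= enorm (centered_sum D p k w : 'rV[R]_n)].
have mbad1 k : measurable (bad1 k) by exact: measurable_enorm_gt.
have mbad2 k : measurable (bad2 k).
  case: k => [|k]; first exact: measurable0.
  by apply: (@measurable_enorm_ge _ _ _ _ (centered_sum D p k.+1)); exact: measurable_centered_sum.
have Pbad k : (k < T)%N -> (P (bad1 k `|` bad2 k) <= (eps / T%:R)%:E)%E.
  move=> kT; apply: (le_trans (measureU2 _ _ _)) => //.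
  rewrite [X in (X + _)%E](iid_enorm_gt_eq0 p_iid (t := k.+1) _ Db) // add0e.
  case: k kT => [|k] kT; first by rewrite measure0 lee_fin divr_ge0 ?ltW.
  have kT' : (0 < k.+1 <= T)%N by rewrite (ltnW kT).
  have rk0 : 0 <= r k.+1 by rewrite !mulr_ge0 ?sqrtr_ge0 ?ltW.
  have b2 : 0 < 2 * beta by rewrite mulr_gt0.
  apply: (le_trans (centered_sum_tail p_iid b2 Dc kT' rk0)).
  rewrite lee_fin /r.
  have -> : - ((8 * beta * Num.sqrt l * Num.sqrt k.+1%:R) ^+ 2 /
      (16 * (2 * beta) ^+ 2 * k.+1%:R)) = - l.
    rewrite !exprMn !sqr_sqrtr //; field; rewrite ?gt_eqF //.
  by rewrite expRN lnK ?posrE // invf_div invfM [leLHS]mulrCA mulVKf ?pnatr_eq0.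
exists (~` \big[setU/set0]_(k < T) (bad1 k `|` bad2 k)).
have mbad : measurable (\big[setU/set0]_(k < T) (bad1 k `|` bad2 k)).
  by apply: bigsetU_measurable => k _; exact: measurableU.
split; first exact: measurableC.
  rewrite probability_setC // EFinB leeB //.
  apply: (le_trans (Boole_inequality P (A := fun k => bad1 k `|` bad2 k) (n := T) _)) => [k _|].
    exact: measurableU.
  apply: (@le_trans _ _ (\sum_(k < T) (eps / T%:R)%:E)%E).
    by apply: lee_sum => k _; exact: Pbad.
  by rewrite sumEFin sumr_const card_ord lee_fin -[eps / _ *+ T]mulr_natr divfK ?gt_eqF.
move=> w; rewrite -(bigcup_mkord T (fun k => bad1 k `|` bad2 k)) => good.
have good1 t : (1 <= t <= T)%N -> enorm (p t w : 'rV[R]_n) <= beta.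
  case: t => // t tT; rewrite leNgt; apply/negP => h.
  by apply: good; exists t => //; left.
have good2 t : (2 <= t <= T)%N ->
    enorm (\sum_(1 <= s < t) ((p s w : 'rV[R]_n) - pbar)) <= r t.-1.
  case: t => [|[|t]] // tT; rewrite leNgt; apply/negP => h.
  by apply: good; exists t.+1 => //; right; exact: ltW.
have := run w; rewrite deltaE => runw.
apply: (OLFW_violation_bound n0 T0 KE B0 _ HX d0 b0 L0 _ _ muE Hf _ gE v1X runw good1 mb good2).
- by rewrite e0 e1.
- exact: constraint_range_ge0.
- move=> Bb; apply: (constraint_range_le HX supp' (ltW b0)).
  by rewrite Bb divr_ge0 ?ltW.
- move=> t y tT Xy; apply: le_trans (utility_range_ge HX Hf tT Xy X0).
  rewrite (utility_normalized (Hf t tT)) subr0; exact: ler_norm.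
Qed.
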